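(* Let $n\ge1$, let $q\in F^*$ be a root of unity of order $N\ge2$, and let $V$ be of Cartan type $A_n$: $q_{ii}=q$ for all $i$, $q_{i,i+1}q_{i+1,i}=q^{-1}$ for $1\le i<n$, and $q_{ij}q_{ji}=1$ for $|i-j|\ge2$. Then $$\dim\mathfrak{L}(V)=N^{\binom{n+1}{2}}-1+\sum_{j=1}^{\lfloor (n-1)/2\rfloor}(-1)^j\sum_{n_1=1}^{n-2}\sum_{n_2=1}^{n_1-2}\cdots\sum_{n_j=1}^{n_{j-1}-2}\Big(N^{\binom{n_j+1}{2}}-1\Big)\prod_{i=1}^{j}\Big(N^{\binom{n_{i-1}-n_i}{2}}-N^{\binom{n_{i-1}-n_i-1}{2}}\Big),$$ where $n_0:=n$, $\binom{k}{2}=k(k-1)/2$ (so $\binom{0}{2}=\binom12=0$), and empty sums are $0$.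
   Context: $F$ is an algebraically closed field of characteristic $0$. $V$ is a braided vector space of diagonal type with basis $x_1,\dots,x_n$ and braiding $C(x_i\otimes x_j)=q_{ij}x_j\otimes x_i$; $\mathfrak{B}(V)$ is its Nichols algebra, $\mathbb{Z}^n$-graded with $\deg x_i=e_i$, $\chi(e_i,e_j)=q_{ij}$ and $p_{uv}:=\chi(\deg u,\deg v)$ for homogeneous $u,v$. For homogeneous $x,y$, $[x,y]:=yx-p_{yx}xy$, and the Nichols braided Lie algebra $\mathfrak{L}(V)$ is the linear span in $\mathfrak{B}(V)$ of all iterated brackets (any bracketing) of $x_1,\dots,x_n$. *)

(* Defs.v *)
From HB Require Import structures.
From mathcomp Require Import all_boot all_order all_algebra all_fingroup.
Set Implicit Arguments. Unset Strict Implicit. Unset Printing Implicit Defensive.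
Import GRing.Theory.
Local Open Scope ring_scope.

(* Binary trees = bracketings; leaves are the generators x_i (i : 'I_n). *)
Inductive btree (T : Type) : Type :=
| BLeaf of T
| BNode of btree T & btree T.

Fixpoint bsize T (t : btree T) : nat :=
  match t with BLeaf _ => 1%N | BNode a b => (bsize a + bsize b)%N end.

Fixpoint bdeg n (t : btree 'I_n) (i : 'I_n) : nat :=
  match t with BLeaf x => (x == i : nat) | BNode a b => (bdeg a i + bdeg b i)%N end.

Fixpoint btrees_fuel n (fuel k : nat) : seq (btree 'I_n) :=
  match fuel with
  | 0 => [::]
  | f.+1 =>
      if k == 1%N then [seq BLeaf x | x <- enum 'I_n]
      else flatten [seq [seq BNode t1 t2 | t1 <- btrees_fuel n f a,
                                          t2 <- btrees_fuel n f (k - a)]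
                   | a <- iota 1 k.-1]
  end.
Definition btrees n k := btrees_fuel n k k.

Section Nichols.
Variables (F : fieldType) (n : nat) (q : 'I_n -> 'I_n -> F).

Definition chi (a b : 'I_n -> nat) : F :=
  \prod_(i < n) \prod_(j < n) q i j ^+ (a i * b j).

(* Elements of the tensor algebra T(V) as coefficient functions on words. *)
Definition tmul (a : nat) (u v : seq 'I_n -> F) : seq 'I_n -> F :=
  fun w => u (take a w) * v (drop a w).

(* the tensor of the bracket: [x,y] = y x - p_{yx} x y; BNode a b = [a,b] *)
Fixpoint bvec (t : btree 'I_n) : seq 'I_n -> F :=
  match t with
  | BLeaf i => fun w => (w == [:: i])%:R
  | BNode a b => fun w =>
      tmul (bsize b) (bvec b) (bvec a) w
      - chi (bdeg b) (bdeg a) * tmul (bsize a) (bvec a) (bvec b) w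
  end.

Definition Tk (k : nat) := {ffun k.-tuple 'I_n -> F^o}.

Definition perm_word k (s : 'S_k) (w : k.-tuple 'I_n) : k.-tuple 'I_n :=
  [tuple tnth w ((s^-1)%g b) | b < k].

(* Matsumoto lift of s acting on x_w: product of q over the inversions of s *)
Definition qsym_coef k (s : 'S_k) (w : k.-tuple 'I_n) : F :=
  \prod_(a < k) \prod_(b < k | (a < b)%N && (s b < s a)%N) q (tnth w a) (tnth w b).

(* quantum symmetrizer Omega_k on T^k(V); B^k(V) = T^k(V)/ker Omega_k *)
Definition omega k (u : Tk k) : Tk k :=
  \sum_(w : k.-tuple 'I_n) \sum_(s : 'S_k)
     (u w * qsym_coef s w) *: [ffun v : k.-tuple 'I_n => ((v == perm_word s w)%:R : F^o)].

Definition restrict k (f : seq 'I_n -> F) : Tk k := [ffun w : k.-tuple 'I_n => (f (tval w) : F^o)].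

(* dimension of the degree-k part of L(V) inside B^k(V) ~ Omega_k(T^k(V)) *)
Definition dimL (k : nat) : nat :=
  \dim (span [seq omega (restrict k (bvec t)) | t <- btrees n k]).

End Nichols.

Fixpoint Schain (N : nat) (j m : nat) : int :=
  match j with
  | 0 => ((N%:Z) ^+ 'C(m.+1, 2) - 1)%R
  | j'.+1 => (\sum_(1 <= m' < m.-1)
                ((N%:Z) ^+ 'C(m - m', 2) - (N%:Z) ^+ 'C(m - m' - 1, 2)) * Schain N j' m')%R
  end.

Definition rhs (N n : nat) : int :=
  ((N%:Z) ^+ 'C(n.+1, 2) - 1 + \sum_(1 <= j < ((n - 1)./2).+1) (-1) ^+ j * Schain N j n)%R.

(* Main.v *)
Require Import Defs.
From HB Require Import structures.
From mathcomp Require Import all_boot all_order all_algebra all_fingroup.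
From mathcomp Require Import ring zify.
Set Implicit Arguments. Unset Strict Implicit. Unset Printing Implicit Defensive.
Import GRing.Theory.
Local Open Scope ring_scope.

(** The Nichols algebra is realized on the span A of the exponent functions
    e : {positive roots of A_n} -> Z/N.  Explicit q-difference operators R_i
    (right multiplication by x_i) and D_i (right skew derivation) satisfy
    D_i R_j = delta_ij + q_ij R_j D_i; the vector 1 generates A under the R_i,
    and only its multiples are killed by every D_i.  Iterating the D_i turns
    the kernel of the quantum symmetrizer on T^k(V) into the kernel of
    w |-> R_w 1, so the degree k part of B(V) has as basis the exponents of
    total degree k.  The relations x_i x_j = q_ij x_j x_i (|i-j| > 1) and
    x_i^N = 0 follow from the same D_i criterion, and they suffice to show
    that L(V) vanishes in degrees with disconnected support and is everything
    in degrees with connected support: [u,v] and [v,u] both lie in L(V), which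
    gives uv unless chi(u,v) chi(v,u) = 1, and otherwise lets one rotate words.
    Hence dim L(V) counts the nonzero exponents with connected support, and
    splitting the other ones at their first gap gives the recursion behind the
    alternating sum. *)

(** * Exponents of PBW monomials *)

(** Each operator is a sum, over the left ends a of the roots in column i, of a scalar times a
    translation of exponents. In D_i R_j and R_j D_i the summand for a pair (a, b) lands on the same
    exponent, so the commutation rule is checked pair by pair on scalars. Only the pairs with i = j
    and a = b leave a remainder. No multiplication table of PBW monomials is computed: identities
    between words in the R_i are tested by commuting them past the D_i.

    The obstacle on the Lie side is that chi(u,v) chi(v,u) can equal 1; then [u,v] and [v,u] are
    proportional and only allow uv to be rotated into vu. Rotating a single letter requires the rest
    of the word to stay connected. Once two different letters occur, this can fail only for an
    interior letter j that occurs once. Such a j separates the word instead: letters below j commute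
    up to a scalar with letters above j, and the word can be cut there. *)

Definition pos_root n := {x : 'I_n * 'I_n | (x.1 <= x.2)%N}.
(* Exponents live in Z/N with N = p.+2, so that replacing one root by another is a translation; the coefficients of the operators vanish exactly on the translations that wrap around. *)
Definition expo n p := {ffun pos_root n -> 'I_p.+2}.

Section Exponents.
Variables n p : nat.
Implicit Types (e : expo n p) (a b c i j l : 'I_n).

Definition ent e a b : 'I_p.+2 := oapp e 0 (insub (a, b)).

Definition unit_expo a b : expo n p := [ffun x => (val x == (a, b))%:R].

Definition prv i : 'I_n := Ordinal (leq_ltn_trans (leq_pred i) (ltn_ord i)).

(* Adding [step a i] replaces one copy of the root [a, i-1] by [a, i]; when a = i it adds the simple root. *)
Definition step a i : expo n p :=
  unit_expo a i - (if (a < i)%N then unit_expo a (prv i) else 0).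

Lemma entE e a b (ab : (a <= b)%N) : ent e a b = e (exist _ (a, b) ab).
Proof. by rewrite /ent insubT. Qed.

Lemma entD e e' a b : ent (e + e') a b = ent e a b + ent e' a b.
Proof. by rewrite /ent; case: insubP => [x _ _|_] /=; rewrite ?ffunE ?addr0. Qed.

Lemma entN e a b : ent (- e) a b = - ent e a b.
Proof. by rewrite /ent; case: insubP => [x _ _|_] /=; rewrite ?ffunE ?oppr0. Qed.

Lemma ent0 a b : ent 0 a b = 0.
Proof. by rewrite /ent; case: insubP => [x _ _|_] /=; rewrite ?ffunE. Qed.

Lemma expoP e e' : (forall a b, (a <= b)%N -> ent e a b = ent e' a b) -> e = e'.
Proof.
by move=> h; apply/ffunP => -[[a b] /= ab]; rewrite -!entE; apply: h.
Qed.

Lemma ent_unit a b c i : (c <= i)%N ->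
  ent (unit_expo a b) c i = ((c == a) && (i == b))%:R.
Proof. by move=> ci; rewrite entE ffunE /= xpair_eqE. Qed.

Lemma ent_step a i c j : (c <= j)%N ->
  ent (step a i) c j =
  if c == a then (j == i)%:R - ((a < i)%N && (j == prv i))%:R else 0.
Proof.
move=> cj; rewrite entD entN ent_unit //; case: ltnP => ai.
  by rewrite ent_unit //; case: (c == a); rewrite /= ?subr0.
by rewrite ent0 /=; case: (c == a); rewrite /= ?subr0.
Qed.

Lemma prv_val i : val (prv i) = i.-1. Proof. by []. Qed.

Lemma prv_eq (a i j : 'I_n) : (a < i)%N -> (prv i == j) = (i == j.+1 :> nat).
Proof. by move=> ai; rewrite -val_eqE /=; apply/eqP/eqP; lia. Qed.

Lemma prv_inj (a b i j : 'I_n) : (a < i)%N -> (b < j)%N -> (prv i == prv j) = (i == j).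
Proof. by move=> ai bj; rewrite -!val_eqE /=; apply/eqP/eqP; lia. Qed.

Lemma ent_step_same i a b e : (a <= i)%N -> (b <= i)%N ->
  ent (e + step b i) a i = ent e a i + (a == b)%:R.
Proof.
move=> ai bi; rewrite entD ent_step // eqxx; case: (a == b) => //.
by case: ltnP => //= bi'; rewrite -?val_eqE /= ?gtn_eqF ?subr0 //; lia.
Qed.

Lemma ent_step_prv i a b e : (a <= i)%N -> (b < i)%N ->
  ent (e - step a i) b (prv i) = ent e b (prv i) + (a == b)%:R.
Proof.
move=> ai bi; rewrite entD entN ent_step; last by rewrite /=; lia.
rewrite [b == a]eq_sym; case: (a =P b) => [ab|_]; last by rewrite subr0 addr0.
by subst b; rewrite bi eqxx -val_eqE /= ltn_eqF ?sub0r ?opprK //; lia.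
Qed.

Definition deg e l : nat :=
  (\sum_(x : pos_root n | ((val x).1 <= l)%N && (l <= (val x).2)%N) (e x : nat))%N.

Lemma val_add1 (x : 'I_p.+2) : x + 1 != 0 -> val (x + 1) = x.+1.
Proof.
move=> h; have lx := ltn_ord x.
have E : val (x + 1) = ((x + 1) %% p.+2)%N by rewrite /= [(1 %% _)%N]modn_small.
rewrite E addn1 modn_small // ltn_neqAle lx andbT.
apply: contra h => /eqP xp; apply/eqP/val_inj.
by rewrite E addn1 xp modnn.
Qed.

Lemma deg_unit e a b l : (a <= b)%N -> ent e a b + 1 != 0 ->
  deg (e + unit_expo a b) l = (deg e l + ((a <= l <= b)%N : nat))%N.
Proof.
move=> ab; rewrite entE => h; rewrite /deg.
set r : pos_root n := exist _ _ _ in h.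
have hr x : x != r -> (e + unit_expo a b) x = e x.
  move=> xr; rewrite !ffunE (_ : val x == (a, b) = false) ?addr0 //.
  by apply: contraNF xr => /eqP hx; apply/eqP/val_inj.
have hrr : val ((e + unit_expo a b) r) = (val (e r)).+1.
  by rewrite !ffunE eqxx mulr1n val_add1.
case abl: (a <= l <= b)%N.
  rewrite (bigD1 r) //= [in RHS](bigD1 r) //= hrr -addn1 addnAC.
  by congr (_ + _ + _)%N; apply: eq_bigr => x /andP[_ /hr ->].
rewrite addn0; apply: eq_bigr => x hx; rewrite hr //.
by apply: contraFneq abl => xr; move: hx; rewrite xr.
Qed.

Lemma deg_step e a i l : (a <= i)%N ->
  ((a < i)%N -> ent e a (prv i) != 0) -> ent e a i + 1 != 0 ->
  deg (e + step a i) l = (deg e l + ((i == l) : nat))%N.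
Proof.
rewrite /step; case: ltnP => [ai _ /(_ isT) h1 h2|ia ai _ h].
  have ap : (a <= prv i)%N by rewrite prv_val -ltnS prednK //; lia.
  have pi : (prv i == i) = false by rewrite -val_eqE prv_val /=; lia.
  (* [f] is e with one copy of [a, i-1] removed. Going from [f] to e and from [f] to the target both
     add a single root without wrapping, so [deg_unit] applies twice. *)
  set f := e - unit_expo a (prv i).
  have fE : ent f a (prv i) + 1 = ent e a (prv i).
    by rewrite entD entN ent_unit // !eqxx subrK.
  have f2 : ent f a i = ent e a i.
    by rewrite entD entN ent_unit ?(ltnW ai) // eqxx eq_sym pi oppr0 addr0.
  have -> : e + (unit_expo a i - unit_expo a (prv i)) = f + unit_expo a i.
    by rewrite addrCA addrC.
  rewrite deg_unit ?f2 ?(ltnW ai) //.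
  have -> : deg e l = (deg f l + ((a <= l <= prv i)%N : nat))%N.
    by rewrite -deg_unit ?fE // subrK.
  rewrite -addnA; congr (_ + _)%N; rewrite -val_eqE /= {ap pi f fE f2}; lia.
have ia' : i = a by apply: val_inj; apply/eqP; rewrite eqn_leq ia ai.
move: h; rewrite {ia ai}ia' subr0 => h; rewrite deg_unit //.
by rewrite -eqn_leq.
Qed.

End Exponents.

(** * Coefficients of the operators *)

Section Coefficients.
Variables (F : fieldType) (n p : nat) (q0 : F).
Hypothesis prim : p.+2.-primitive_root q0.
Implicit Types (e x : expo n p) (a b c i j l : 'I_n).

Definition qexp (x : 'I_p.+2) : F := q0 ^+ x.

Lemma q0_neq0 : q0 != 0.
Proof. by apply: contra_eq_neq (prim_expr_order prim) => ->; rewrite expr0n eq_sym oner_neq0. Qed.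

Lemma q0_neq1 : 1 - q0 != 0.
Proof.
rewrite subr_eq0; have := prim_order_dvd prim 1.
by rewrite expr1 dvdn1 [1 == _]eq_sym /= => <-.
Qed.

Lemma qexp0 : qexp 0 = 1. Proof. by []. Qed.

Lemma qexpD (u v : 'I_p.+2) : qexp (u + v) = qexp u * qexp v.
Proof. by rewrite /qexp /= (prim_expr_mod prim) exprD. Qed.

Lemma qexp_neq0 (u : 'I_p.+2) : qexp u != 0.
Proof. by rewrite expf_neq0 ?q0_neq0. Qed.

Lemma qexpN (u : 'I_p.+2) : qexp (- u) = (qexp u)^-1.
Proof.
by apply: (mulIf (qexp_neq0 u)); rewrite -qexpD addNr mulVf ?qexp_neq0.
Qed.

Lemma qexp1 : qexp 1 = q0.
Proof. by rewrite /qexp /= modn_small ?expr1. Qed.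

Lemma qexp_eq1 (u : 'I_p.+2) : (qexp u == 1) = (u == 0).
Proof.
rewrite -(prim_order_dvd prim) -val_eqE /=; apply/idP/eqP => [|->] //.
by move/dvdn_leq; case: (val u) (ltn_ord u) => //= m hm /(_ isT); rewrite leqNgt hm.
Qed.

Lemma qexp_bool (t : bool) : qexp t%:R = if t then q0 else 1.
Proof. by case: t; rewrite ?mulr1n ?qexp1. Qed.

Definition ycoef i a e : F := \prod_(c < n | (c < a)%N) qexp (ent e c i).
Definition xval i a e : F := if (a < i)%N then qexp (- ent e a (prv i)) else 0.
Definition xcoef i a e : F := \prod_(c < n | (c < a)%N) xval i c e.

(* The D-coefficients treat the missing entry e(i, i-1) as infinite, whence the value 0 of q^{-e(i, i-1)} in [xval] for a = i; this makes the sum in [rd_coef_sum] telescope to 1. *)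
Definition rcoef i a e : F :=
  ((a < i)%N ==> (ent e a (prv i) != 0))%:R * ycoef i a e
    * (1 - q0 * qexp (ent e a i)) / (1 - q0).
Definition dcoef i a e : F :=
  (ent e a i != 0)%:R * xcoef i a e * (1 - q0^-1 * xval i a e).

Definition std_braid i j : F :=
  if i == j then q0 else if i == j.+1 :> nat then q0^-1 else 1.

Lemma ycoefD i a e x : ycoef i a (e + x) = ycoef i a e * ycoef i a x.
Proof. by rewrite /ycoef -big_split; apply: eq_bigr => c _; rewrite entD qexpD. Qed.

Lemma ycoefN i a x : ycoef i a (- x) = (ycoef i a x)^-1.
Proof.
by rewrite /ycoef -prodfV; apply: eq_bigr => c _; rewrite entN qexpN.
Qed.

Lemma ycoef_neq0 i a e : ycoef i a e != 0.
Proof. by apply/prodf_neq0 => c _; apply: qexp_neq0. Qed.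

(** The scalar of D_i is the inverse of the scalar of R_(i-1), so a single shift rule, [ycoef_step],
    serves both kinds of operators. *)
Lemma xcoefE i a e : (a <= i)%N -> xcoef i a e = (ycoef (prv i) a e)^-1.
Proof.
move=> ai; rewrite -ycoefN; apply: eq_bigr => c ca.
by rewrite /xval (leq_trans ca ai) entN.
Qed.

Lemma xcoef_neq0 i a e : (a <= i)%N -> xcoef i a e != 0.
Proof. by move=> ai; rewrite xcoefE // invr_neq0 ?ycoef_neq0. Qed.

Lemma ycoef_step i a b j : (a <= i.+1)%N ->
  ycoef i a (step p b j) =
  if (b < a)%N then qexp ((i == j)%:R - ((b < j)%N && (i == prv j))%:R) else 1.
Proof.
move=> ai; case: ifP => ba.
  rewrite /ycoef (bigD1 b) //= big1 ?mulr1 => [|c /andP[ca cb]].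
    by rewrite ent_step ?eqxx //; lia.
  by rewrite ent_step ?(negbTE cb) ?qexp0 //; lia.
rewrite /ycoef big1 // => c ca; rewrite ent_step ?qexp0; last lia.
by case: eqP => // cb; rewrite -cb ca in ba.
Qed.

Lemma xvalD i a e x : xval i a (e + x) = xval i a e / qexp (ent x a (prv i)).
Proof.
by rewrite /xval; case: ifP => _; rewrite ?mul0r // entD opprD qexpD [qexp (- ent x _ _)]qexpN.
Qed.

Lemma qexp_nat_diff (t u : bool) :
  qexp (t%:R - u%:R) = (if t then q0 else 1) / (if u then q0 else 1).
Proof. by rewrite qexpD qexpN !qexp_bool. Qed.

(** The entries tested by one operator are changed by the other only if a = b and i = j - 1; then
    both sides say that e(a, i) is neither 0 nor 1. *)
Lemma rcoef_indicator i j a b e : i != j -> (a <= i)%N -> (b <= j)%N ->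
  ((b < j)%N ==> (ent e b (prv j) != 0)) && (ent (e + step p b j) a i != 0)
  = ((b < j)%N ==> (ent (e - step p a i) b (prv j) != 0)) && (ent e a i != 0).
Proof.
move=> ij ai bj; rewrite entD ent_step // (negbTE ij) sub0r.
case: (ltnP b j) => [ltbj|_] /=; last by rewrite oppr0; case: (a == b); rewrite addr0.
rewrite entD entN ent_step; last by rewrite /=; lia.
rewrite [b == a]eq_sym; case: (a =P b) => [ab|_]; last by rewrite subr0 addr0 andbC.
subst b; case: (ltnP a i) => [ltai|_].
  rewrite (prv_inj ltbj ltai) [j == i]eq_sym (negbTE ij) subr0 [i == prv j]eq_sym.
  by case: (prv j =P i) => [->|_]; rewrite ?mulr0n ?subr0 andbC.
by rewrite /= mulr0n subr0 [i == prv j]eq_sym; case: (prv j =P i) => [->|_]; rewrite ?mulr0n ?subr0 andbC.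
Qed.

Lemma rd_coef_diff i j a b e : i != j -> (a <= i)%N -> (b <= j)%N ->
  rcoef j b e * dcoef i a (e + step p b j)
  = std_braid i j * (dcoef i a e * rcoef j b (e - step p a i)).
Proof.
(* If i = j + 1, then R_j changes the column i - 1 that D_i reads, and every affected power of q
   changes by [T] or its inverse. Otherwise [T] is 1 and only the indicators can interact. *)
move=> ij ai bj; set T := if i == j.+1 :> nat then q0 else 1.
have q0n := q0_neq0; have q1n := q0_neq1.
have Tn : T != 0 by rewrite /T; case: ifP; rewrite ?oner_neq0.
have -> : std_braid i j = T^-1.
  by rewrite /std_braid (negbTE ij) /T; case: ifP; rewrite ?invr1.
have Yy : ycoef j b (e - step p a i) = ycoef j b e * (if (a < b)%N then T else 1).
  rewrite ycoefD ycoefN ycoef_step 1?leqW //; case: ifP => ab; rewrite ?invr1 //.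
  rewrite qexp_nat_diff [j == i]eq_sym (negbTE ij) [j == _]eq_sym.
  case: (ltnP a i) => [lai|]; first by rewrite (prv_eq _ lai) invf_div divr1 mulrC.
  move=> ia; have -> : T = 1 by rewrite /T; case: eqP => //; lia.
  by rewrite /= divr1 invr1.
have yy : qexp (ent (e - step p a i) b j)
    = qexp (ent e b j) * (if (a == b) && (a < i)%N then T else 1).
  rewrite entD entN ent_step // qexpD qexpN [b == a]eq_sym; case: (a == b); last by rewrite qexp0 invr1.
  rewrite qexp_nat_diff [j == i]eq_sym (negbTE ij) [j == _]eq_sym /=.
  case: (ltnP a i) => [lai|_]; last by rewrite /= divr1 invr1.
  by rewrite (prv_eq _ lai) invf_div divr1.
have Xx : xcoef i a (e + step p b j) = xcoef i a e * (if (b < a)%N then T^-1 else 1).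
  rewrite !xcoefE // ycoefD invfM; congr (_ * _).
  rewrite ycoef_step /=; last lia.
  case: ifP => ba; last by rewrite invr1.
  rewrite qexp_nat_diff (prv_eq _ (leq_trans ba ai)).
  case: (ltnP b j) => [lbj|_]; last by rewrite divr1.
  by rewrite (prv_inj (leq_trans ba ai) lbj) (negbTE ij) divr1.
have xx : xval i a (e + step p b j) = xval i a e * (if a == b then T^-1 else 1).
  case: (ltnP a i) => [lai|ia]; last by rewrite /xval ltnNge ia !mul0r.
  rewrite xvalD; congr (_ * _); rewrite ent_step; last by rewrite /=; lia.
  case: eqP => [ab|_]; last by rewrite qexp0 invr1.
  rewrite qexp_nat_diff (prv_eq _ lai).
  case: (ltnP b j) => [lbj|_]; last by rewrite divr1.
  by rewrite (prv_inj lai lbj) (negbTE ij) divr1.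
rewrite /rcoef /dcoef Yy yy Xx xx.
have := rcoef_indicator e ij ai bj.
set A := _ ==> _; set B := _ != 0; set A' := _ ==> _; set B' := _ != 0 => h.
have {}h : (A%:R : F) * B%:R = A'%:R * B'%:R by rewrite -!natrM !mulnb h.
transitivity ((A%:R * B%:R) * (ycoef j b e * xcoef i a e / (1 - q0)
   * (if (b < a)%N then T^-1 else 1) * (1 - q0 * qexp (ent e b j))
   * (1 - q0^-1 * (xval i a e * (if a == b then T^-1 else 1))))); first by ring.
rewrite h; clear h.
suff h : (if (b < a)%N then T^-1 else 1) * (1 - q0 * qexp (ent e b j))
   * (1 - q0^-1 * (xval i a e * (if a == b then T^-1 else 1)))
  = T^-1 * (if (a < b)%N then T else 1) * (1 - q0^-1 * xval i a e) *
   (1 - q0 * (qexp (ent e b j) * (if (a == b) && (a < i)%N then T else 1))).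
  transitivity (A'%:R * B'%:R * (ycoef j b e * xcoef i a e / (1 - q0)) *
    ((if (b < a)%N then T^-1 else 1) * (1 - q0 * qexp (ent e b j))
   * (1 - q0^-1 * (xval i a e * (if a == b then T^-1 else 1))))); first by ring.
  by rewrite h; ring.
case: (ltngtP a b) => [ab|ba|/val_inj ab].
- by rewrite -val_eqE (ltn_eqF ab) /= mulVf //; ring.
- by rewrite -val_eqE (gtn_eqF ba) /=; ring.
subst b; rewrite eqxx /= mul1r mulr1.
rewrite /T {Yy yy Xx xx} in Tn *; case: (nat_of_ord i =P j.+1) Tn => [tij|_] Tn; last first.
  by case: (a < i)%N; field; rewrite ?q0n ?q1n.
(* In the remaining case i = j + 1, a = b. With y = q^e(a, j) the claim is (1 - qy)(1 - q^-2 y^-1) =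
   q^-1 (1 - q^-1 y^-1)(1 - q^2 y). *)
have lai : (a < i)%N by lia.
have -> : xval i a e = (qexp (ent e a j))^-1.
  rewrite /xval lai qexpN; congr (qexp (ent e a _))^-1.
  by apply/eqP; rewrite (prv_eq _ lai) tij.
by rewrite lai; have := qexp_neq0 (ent e a j); move: (qexp _) => y yn; field; rewrite ?q0n ?yn.
Qed.

Lemma ycoef_same i a b e : (a <= i)%N -> (b <= i)%N ->
  ycoef i b (e - step p a i) = ycoef i b e * (if (a < b)%N then q0^-1 else 1).
Proof.
move=> ai bi; rewrite ycoefD ycoefN ycoef_step 1?leqW // eqxx.
case: ifP => ab; last by rewrite invr1.
rewrite qexp_nat_diff (_ : (_ < _)%N && _ = false) ?divr1 //.
by rewrite -val_eqE /=; lia.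
Qed.

Lemma xcoef_same i a b e : (a <= i)%N -> (b <= i)%N ->
  xcoef i a (e + step p b i) = xcoef i a e * (if (b < a)%N then q0 else 1).
Proof.
move=> ai bi; rewrite !xcoefE // ycoefD invfM; congr (_ * _).
rewrite ycoef_step /=; last lia.
case: ifP => ba; last by rewrite invr1.
have bi' := leq_trans ba ai; rewrite qexp_nat_diff bi' eqxx -val_eqE /= ltn_eqF.
  by rewrite mul1r invrK.
lia.
Qed.

Lemma xval_same i a b e : (a <= i)%N -> (b <= i)%N ->
  xval i a (e + step p b i) = xval i a e * (if a == b then q0 else 1).
Proof.
move=> ai bi; case: (ltnP a i) => [lai|ia]; last by rewrite /xval ltnNge ia !mul0r.
rewrite xvalD; congr (_ * _); rewrite ent_step; last by rewrite /=; lia.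
case: eqP => [ab|_]; last by rewrite qexp0 invr1.
subst b; rewrite lai eqxx qexp_nat_diff -val_eqE /= ltn_eqF.
  by rewrite mul1r invrK.
lia.
Qed.

Lemma rd_coef_same i a b e : a != b -> (a <= i)%N -> (b <= i)%N ->
  rcoef i b e * dcoef i a (e + step p b i)
  = q0 * (dcoef i a e * rcoef i b (e - step p a i)).
Proof.
move=> ab ai bi; have q0n := q0_neq0.
rewrite /rcoef /dcoef ent_step_same // ycoef_same // xcoef_same // xval_same //.
rewrite (negbTE ab) addr0.
have -> : ent (e - step p a i) b i = ent e b i.
  by rewrite entD entN ent_step // eq_sym (negbTE ab) subr0.
have -> : ((b < i)%N ==> (ent (e - step p a i) b (prv i) != 0))
        = ((b < i)%N ==> (ent e b (prv i) != 0)).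
  by case: ltnP => //= bi'; rewrite ent_step_prv // (negbTE ab) addr0.
case: (ltngtP a b) => [lab|lba|/val_inj] //.
- by field; rewrite ?q0n ?q0_neq1.
- by field; rewrite ?q0n ?q0_neq1.
by move/eqP; rewrite (negbTE ab).
Qed.

Definition zval i e c := qexp (ent e c i) * xval i c e.

Lemma rd_coef_diag i a e : (a <= i)%N ->
  rcoef i a e * dcoef i a (e + step p a i)
  - q0 * (dcoef i a e * rcoef i a (e - step p a i))
  = (\prod_(c < n | (c < a)%N) zval i e c) * (1 - zval i e a).
Proof.
move=> ai; have q0n := q0_neq0; have q1n := q0_neq1.
rewrite big_split /= -/(ycoef i a e) -/(xcoef i a e) /zval.
rewrite /rcoef /dcoef ent_step_same // ycoef_same // xcoef_same // xval_same //.
rewrite eqxx ltnn.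
have -> : qexp (ent (e - step p a i) a i) = qexp (ent e a i) / q0.
  have := ent_step_same (e - step p a i) ai ai; rewrite subrK eqxx => ->.
  by rewrite qexpD qexp1 mulfK.
set A := (_ ==> _); set B := _ != 0; set A' := (_ ==> _); set B' := _ != 0.
have hA : (A%:R : F) * (1 - xval i a e) = 1 - xval i a e.
  rewrite /A /xval; case: ltnP => /= ai'; last by rewrite mul1r.
  case: (ent e a _ =P 0) => [->|_] /=; last by rewrite mul1r.
  by rewrite oppr0 qexp0 subrr mulr0.
have hB : (B%:R : F) * (1 - q0 * qexp (ent e a i)) = 1 - q0 * qexp (ent e a i).
  rewrite /B; case: eqP => [h|_] /=; last by rewrite mul1r.
  move: h; rewrite mulr1n => h.
  by rewrite -qexp1 -qexpD [1 + ent _ _ _]addrC h qexp0 subrr mulr0.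
have hA' : (A'%:R : F) * (1 - q0^-1 * xval i a e) = 1 - q0^-1 * xval i a e.
  rewrite /A' /xval; case: ltnP => /= ai'; last by rewrite mul1r.
  rewrite ent_step_prv // eqxx; case: eqP => [h|_] /=; last by rewrite mul1r.
  move: h; rewrite mulr1n => h.
  have -> : q0^-1 * qexp (- ent e a (prv i)) = 1; last by rewrite subrr mulr0.
  by rewrite qexpN -invfM mulrC -[X in _ * X]qexp1 -qexpD h qexp0 invr1.
have hB' : (B'%:R : F) * (1 - qexp (ent e a i)) = 1 - qexp (ent e a i).
  rewrite /B'; case: eqP => [h|_] /=; last by rewrite mul1r.
  by rewrite h qexp0 subrr mulr0.
transitivity (ycoef i a e * xcoef i a e / (1 - q0) *
  ((A%:R * (1 - xval i a e)) * (B%:R * (1 - q0 * qexp (ent e a i)))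
  - q0 * (A'%:R * (1 - q0^-1 * xval i a e)) * (B'%:R * (1 - qexp (ent e a i))))).
  by field; rewrite ?q0n ?q1n.
by rewrite hA hB hA' hB'; field; rewrite ?q0n ?q1n.
Qed.

Lemma telescope_prod (z : nat -> F) m :
  \sum_(a < m) (\prod_(c < a) z c) * (1 - z a) = 1 - \prod_(c < m) z c.
Proof.
elim: m => [|m IH]; first by rewrite !big_ord0 subrr.
rewrite !big_ord_recr /= IH; ring.
Qed.

(* The prefix product vanishes at a = i because [xval i i] = 0. *)
Lemma rd_coef_sum i e :
  \sum_(a < n | (a <= i)%N) (rcoef i a e * dcoef i a (e + step p a i)
  - q0 * (dcoef i a e * rcoef i a (e - step p a i))) = 1.
Proof.
rewrite (eq_bigr (fun a : 'I_n => (\prod_(c < n | (c < a)%N) zval i e c) * (1 - zval i e a)));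
  last by move=> a; apply: rd_coef_diag.
pose z k := if insub k is Some c then zval i e c else 0.
have zE (c : 'I_n) : z c = zval i e c by rewrite /z valK.
have prodE (m : nat) : (m <= n)%N ->
    \prod_(c < n | (c < m)%N) zval i e c = \prod_(c < m) z c.
  move=> mn; rewrite (big_ord_widen n z mn); apply: eq_bigr => c _; by rewrite zE.
rewrite (eq_bigr (fun a : 'I_n => (\prod_(c < a) z c) * (1 - z a))); last first.
  by move=> a _; rewrite prodE ?zE // ltnW.
have := telescope_prod z i.+1; rewrite (big_ord_widen n (fun a : nat => (\prod_(c < a) z c) * (1 - z a)) (ltn_ord i)) => ->.
rewrite [X in 1 - X](_ : _ = 0) ?subr0 // big_ord_recr /= zE /zval /xval ltnn.
by rewrite !mulr0.
Qed.

End Coefficients.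

(** * Multiplication and skew derivation operators *)

Section WordMatrix.
Variables (F : fieldType) (n d : nat) (X : 'I_n -> 'M[F]_d).

(** Matrices act on row vectors from the right, so a word is applied in reading order and
    concatenation becomes the matrix product. *)
Definition wmx (w : seq 'I_n) : 'M[F]_d := foldr (fun i A => X i *m A) 1%:M w.

Lemma wmx_cat u v : wmx (u ++ v) = wmx u *m wmx v.
Proof. by elim: u => [|i u IH] /=; rewrite ?mul1mx // IH mulmxA. Qed.

Lemma wmx1 i : wmx [:: i] = X i. Proof. exact: mulmx1. Qed.

Lemma wmx_rcons w i : wmx (rcons w i) = wmx w *m X i.
Proof. by rewrite -cats1 wmx_cat wmx1. Qed.

End WordMatrix.

(** * Coordinates on the space with a finite set as basis *)

Section FinBasis.
Variables (F : fieldType) (E : finType).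
Implicit Types (e f : E) (v : 'rV[F]_#|E|).

Definition bas e : 'rV[F]_#|E| := delta_mx 0 (enum_rank e).
Definition cf v e : F := v 0 (enum_rank e).
Definition opmx (g : E -> 'rV[F]_#|E|) : 'M[F]_#|E| := \matrix_k g (enum_val k).

Lemma bas_op g e : bas e *m opmx g = g e.
Proof. by rewrite -rowE rowK enum_rankK. Qed.

Lemma cf_bas e f : cf (bas e) f = (e == f)%:R.
Proof. by rewrite /cf mxE eqxx /= (inj_eq enum_rank_inj) eq_sym. Qed.

Lemma cfP v v' : (forall e, cf v e = cf v' e) -> v = v'.
Proof. by move=> h; apply/rowP => k; have := h (enum_val k); rewrite /cf enum_valK. Qed.

Lemma cfD v v' e : cf (v + v') e = cf v e + cf v' e. Proof. exact: mxE. Qed.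
Lemma cfZ c v e : cf (c *: v) e = c * cf v e. Proof. exact: mxE. Qed.
Lemma cf0 e : cf 0 e = 0. Proof. exact: mxE. Qed.
Lemma cf_sum I r (P : pred I) (g : I -> 'rV[F]_#|E|) e :
  cf (\sum_(i <- r | P i) g i) e = \sum_(i <- r | P i) cf (g i) e.
Proof. exact: summxE. Qed.

Lemma bas_sum v : v = \sum_e cf v e *: bas e.
Proof.
apply: cfP => f; rewrite cf_sum (bigD1 f) //= cfZ cf_bas eqxx mulr1.
by rewrite big1 ?addr0 // => e ef; rewrite cfZ cf_bas (negbTE ef) mulr0.
Qed.

Lemma bas_ext m (A B : 'M[F]_(#|E|, m)) : (forall e, bas e *m A = bas e *m B) -> A = B.
Proof. by move=> h; apply/row_matrixP => k; rewrite !rowE -[k]enum_valK; apply: h. Qed.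

Lemma mulmx_bas v m (A : 'M[F]_(#|E|, m)) : v *m A = \sum_e cf v e *: (bas e *m A).
Proof.
rewrite {1}[v]bas_sum mulmx_suml; apply: eq_bigr => e _; exact/esym/scalemxAl.
Qed.

End FinBasis.

(** * The operators R_i and D_i and their commutation rule *)

Section Operators.
Variables (F : fieldType) (n p : nat) (q0 : F) (q : 'I_n -> 'I_n -> F).
Hypothesis prim : p.+2.-primitive_root q0.
Hypothesis q_diag : forall i, q i i = q0.
Hypothesis q_adj : forall i j : 'I_n, j = i.+1 :> nat -> q i j * q j i = q0^-1.
Hypothesis q_far : forall i j : 'I_n, (i.+1 < j)%N || (j.+1 < i)%N -> q i j * q j i = 1.
Implicit Types (e f : expo n p) (a b c i j l : 'I_n).
Notation step := (step p).
Notation q0n := (q0_neq0 prim).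

Lemma q_neq0 i j : q i j != 0.
Proof.
case: (ltngtP i j) => [ij|ji|/val_inj ->]; last by rewrite q_diag q0n.
- have : q i j * q j i != 0.
    case: (ltngtP i.+1 j) => h; last by rewrite q_adj ?invr_neq0 ?q0n.
      by rewrite q_far ?oner_neq0 ?h.
    lia.
  by rewrite mulf_eq0 negb_or => /andP[].
- have : q j i * q i j != 0.
    case: (ltngtP j.+1 i) => h; last by rewrite q_adj ?invr_neq0 ?q0n.
      by rewrite q_far ?oner_neq0 ?h.
    lia.
  by rewrite mulf_eq0 negb_or => /andP[].
Qed.

(* [std_braid] is the braiding for which the untwisted operators work; any braiding with the same products q_ij q_ji is obtained from it by twisting with [sgm]. *)
Definition sgm i j : F := if (i < j)%N then q i j else 1.

Lemma sgm_neq0 i j : sgm i j != 0.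
Proof. by rewrite /sgm; case: ifP; rewrite ?q_neq0 ?oner_neq0. Qed.

Lemma q_std i j : q i j = std_braid q0 i j * sgm i j / sgm j i.
Proof.
rewrite /std_braid /sgm -val_eqE /=; case: ltngtP => [ij|ji|/val_inj ->].
- by rewrite ifF ?divr1 ?mul1r //; lia.
- rewrite mulr1; apply: (mulIf (q_neq0 j i)); rewrite mulfVK ?q_neq0 //.
  case: eqP => h; first by rewrite mulrC q_adj.
  by rewrite q_far //; apply/orP; right; lia.
by rewrite q_diag mulr1 divr1.
Qed.

(** The bicharacter extending [sgm], at the degree of e and e_j. R_j is multiplied by this factor
    and D_j divided by it, which twists the product by a cocycle. *)
Definition tw j e : F := \prod_(l < n) sgm l j ^+ deg e l.

Lemma tw_neq0 j e : tw j e != 0.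
Proof. by apply/prodf_neq0 => l _; rewrite expf_neq0 ?sgm_neq0. Qed.

Lemma tw_up i j e f : (forall l, deg f l = (deg e l + ((i == l) : nat))%N) ->
  tw j f = tw j e * sgm i j.
Proof.
move=> h; rewrite /tw (eq_bigr (fun l => sgm l j ^+ deg e l * sgm l j ^+ (i == l))).
  rewrite big_split /=; congr (_ * _); rewrite (bigD1 i) //= eqxx expr1.
  by rewrite big1 ?mulr1 // => l li; rewrite eq_sym (negbTE li).
by move=> l _; rewrite h exprD.
Qed.

(** Wrapping of e(a, i) is excluded by the q-integer (e(a, i) + 1)_q in the coefficient, wrapping of
    e(a, i-1) by its indicator. *)
Lemma deg_rcoef i a e : (a <= i)%N -> rcoef q0 i a e != 0 ->
  forall l, deg (e + step a i) l = (deg e l + ((i == l) : nat))%N.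
Proof.
move=> ai h l; apply: deg_step => //.
  move=> lai; apply: contraNneq h => h0.
  by rewrite /rcoef lai h0 eqxx /= !mul0r.
apply: contraNneq h => h0; rewrite /rcoef -(qexp1 p q0) -(qexpD prim) [_ + ent e a i]addrC h0.
by rewrite qexp0 subrr mulr0 mul0r.
Qed.

(** The roles are exchanged: the indicator guards e(a, i), and the factor 1 - q^(-1-e(a, i-1))
    guards e(a, i-1). *)
Lemma deg_dcoef i a e : (a <= i)%N -> dcoef q0 i a e != 0 ->
  forall l, deg e l = (deg (e - step a i)%R l + ((i == l) : nat))%N.
Proof.
move=> ai h l; have hs := ent_step_same (e - step a i) ai ai.
rewrite subrK eqxx mulr1n in hs.
rewrite -(@deg_step _ _ _ a) ?subrK // -?hs.
  move=> lai; rewrite ent_step_prv // eqxx mulr1n; apply: contraNneq h => h0.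
  rewrite /dcoef /xval lai -(qexp1 p q0) -(qexpN prim) -(qexpD prim) -opprD [_ + ent e a _]addrC h0.
  by rewrite oppr0 qexp0 subrr mulr0.
by apply: contraNneq h => h0; rewrite /dcoef h0 eqxx !mul0r.
Qed.

Definition rtw i a e : F := tw i e * rcoef q0 i a e.
Definition dtw i a e : F := dcoef q0 i a e / tw i e.

Lemma rtw_dtw i j a b e : (b <= j)%N ->
  rtw j b e * dtw i a (e + step b j)
  = tw j e / (tw i e * sgm j i) * (rcoef q0 j b e * dcoef q0 i a (e + step b j)).
Proof.
move=> bj; rewrite /rtw /dtw.
(* [tw_up] needs a translation that does not wrap, which a nonzero coefficient guarantees; otherwise
   both sides are 0. *)
have [->|rn] := eqVneq (rcoef q0 j b e) 0; first by rewrite !(mulr0, mul0r).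
by rewrite (tw_up i (deg_rcoef bj rn)); field; rewrite sgm_neq0 tw_neq0.
Qed.

Lemma dtw_rtw i j a b e : (a <= i)%N ->
  dtw i a e * rtw j b (e - step a i)
  = tw j e / (tw i e * sgm i j) * (dcoef q0 i a e * rcoef q0 j b (e - step a i)).
Proof.
move=> ai; rewrite /rtw /dtw.
have [->|rn] := eqVneq (dcoef q0 i a e) 0; first by rewrite !(mulr0, mul0r).
by rewrite (tw_up j (deg_dcoef ai rn)); field; rewrite sgm_neq0 tw_neq0.
Qed.

Definition Rm i := opmx (fun e => \sum_(a < n | (a <= i)%N) rtw i a e *: bas F (e + step a i)).
Definition Dm i := opmx (fun e => \sum_(a < n | (a <= i)%N) dtw i a e *: bas F (e - step a i)).

Lemma bas_Rm i e : bas F e *m Rm i = \sum_(a < n | (a <= i)%N) rtw i a e *: bas F (e + step a i).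
Proof. exact: bas_op. Qed.

Lemma bas_Dm i e : bas F e *m Dm i = \sum_(a < n | (a <= i)%N) dtw i a e *: bas F (e - step a i).
Proof. exact: bas_op. Qed.

Lemma bas_RmDm i j e : bas F e *m Rm j *m Dm i =
  \sum_(b < n | (b <= j)%N) \sum_(a < n | (a <= i)%N)
    (rtw j b e * dtw i a (e + step b j)) *: bas F (e + step b j - step a i).
Proof.
rewrite bas_Rm mulmx_suml; apply: eq_bigr => b _.
rewrite -scalemxAl bas_Dm scaler_sumr; apply: eq_bigr => a _; by rewrite scalerA.
Qed.

Lemma bas_DmRm i j e : bas F e *m Dm i *m Rm j =
  \sum_(b < n | (b <= j)%N) \sum_(a < n | (a <= i)%N)
    (dtw i a e * rtw j b (e - step a i)) *: bas F (e + step b j - step a i).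
Proof.
rewrite bas_Dm mulmx_suml exchange_big /=; apply: eq_bigr => a _.
rewrite -scalemxAl bas_Rm scaler_sumr; apply: eq_bigr => b _.
by rewrite scalerA addrAC.
Qed.

(** On row vectors [Rm j] is applied first, so this is the skew Leibniz rule D_i(v x_j) = delta_ij v
    + q_ij D_i(v) x_j. *)
Lemma Rm_Dm i j : Rm j *m Dm i = (i == j)%:R%:M + q i j *: (Dm i *m Rm j).
Proof.
apply: bas_ext => e; rewrite mulmxDr -scalemxAr !mulmxA bas_RmDm bas_DmRm.
rewrite mul_mx_scalar scaler_sumr.
have off a b : (a <= i)%N -> (b <= j)%N -> (i != j) || (a != b) ->
    rtw j b e * dtw i a (e + step b j) = q i j * (dtw i a e * rtw j b (e - step a i)).
  move=> ai bj ijab; rewrite rtw_dtw // dtw_rtw // q_std.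
  have -> : rcoef q0 j b e * dcoef q0 i a (e + step b j)
      = std_braid q0 i j * (dcoef q0 i a e * rcoef q0 j b (e - step a i)).
    have [ij|ij] := eqVneq i j; last exact: rd_coef_diff.
    subst j; rewrite eqxx /= in ijab; rewrite rd_coef_same //.
    by rewrite /std_braid eqxx.
  by field; rewrite !sgm_neq0 tw_neq0.
have [ij|ij] := eqVneq i j; last first.
  rewrite scale0r add0r; apply: eq_bigr => b bj; rewrite scaler_sumr.
  by apply: eq_bigr => a ai; rewrite scalerA off ?ij.
subst j; rewrite scale1r -[LHS](subrK (\sum_(b < n | (b <= i)%N) q i i *:
  \sum_(a < n | (a <= i)%N) (dtw i a e * rtw i b (e - step a i)) *: bas F (e + step b i - step a i))).
congr (_ + _); rewrite -sumrB.
rewrite -[RHS]scale1r -(rd_coef_sum prim i e) scaler_suml; apply: eq_bigr => b bi.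
rewrite scaler_sumr -sumrB (bigD1 b) //= big1 ?addr0 => [|a /andP[ai ab]].
  rewrite addrK scalerA -scalerBl rtw_dtw // dtw_rtw // /sgm ltnn mulr1 q_diag.
  by rewrite divff ?tw_neq0 // !mul1r.
by rewrite scalerA off ?ab ?orbT // subrr.
Qed.

Lemma cf_Dm v i f : cf (v *m Dm i) f =
  \sum_(a < n | (a <= i)%N) dtw i a (f + step a i) * cf v (f + step a i).
Proof.
rewrite mulmx_bas cf_sum.
under eq_bigr => e _ do rewrite cfZ bas_Dm cf_sum mulr_sumr.
rewrite exchange_big /=; apply: eq_bigr => a _.
rewrite (bigD1 (f + step a i)) //= cfZ cf_bas addrK eqxx mulr1 mulrC.
rewrite big1 ?addr0 // => e ef; rewrite cfZ cf_bas subr_eq (negbTE ef).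
by rewrite !mulr0.
Qed.

(* If the columns before i vanish on the support of v, the terms of D_i hit distinct basis vectors, so column i vanishes too. *)
Lemma Dm_kernel (v : 'rV[F]_#|expo n p|) : (forall i, v *m Dm i = 0) ->
  forall e, cf v e != 0 -> e = 0.
Proof.
move=> vD.
suff col m e : cf v e != 0 -> forall a i, (a <= i)%N -> (i < m)%N -> ent e a i = 0.
  by move=> e ve; apply: expoP => a i ai; rewrite ent0 (col n e ve).
elim: m e => // m IH e ve a i ai; rewrite ltnS leq_eqVlt => /orP[/eqP im|]; last exact: IH.
have IHe := IH e ve; apply/eqP; apply: contraNT ve => eai.
have := congr1 (fun u => cf u (e - step a i)) (vD i).
rewrite cf0 cf_Dm (bigD1 a) //= subrK big1 ?addr0 => [/eqP|b /andP[bi ba]].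
  have [-> //|ve] := eqVneq (cf v e) 0.
  rewrite mulf_eq0 (negbTE ve) orbF mulf_eq0 invr_eq0 (negbTE (tw_neq0 i e)) orbF.
  rewrite !mulf_eq0 (negbTE (xcoef_neq0 prim e ai)) orbF eai oner_eq0 /=.
  rewrite /xval; case: ltnP => lai; last by rewrite mulr0 subr0 oner_eq0.
  rewrite IHe ?oppr0 ?qexp0 ?mulr1 /=; try lia.
  by rewrite subr_eq0 eq_sym invr_eq1 eq_sym -subr_eq0 (negbTE (q0_neq1 prim)).
(* For b different from a this exponent is not in the support of v: in column i - 1 it has the entry
   1 at row a, or -1 at row b when a = i, while earlier columns vanish on the support. *)
have [->|ve'] := eqVneq (cf v (e - step a i + step b i)) 0; first by rewrite mulr0.
have one0 : (1 : 'I_p.+2) != 0 by [].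
have [lai|lia'] := ltnP a i.
  case/eqP: one0; rewrite -(IH _ ve' a (prv i)); try by rewrite /=; lia.
  rewrite entD ent_step_prv // eqxx IHe ?ent_step; try by rewrite /=; lia.
  by rewrite eq_sym (negbTE ba) addr0 add0r.
have ia : a = i by apply: val_inj; apply/eqP; rewrite eqn_leq ai lia'.
subst a; have lbi : (b < i)%N by rewrite ltn_neqAle bi andbT; apply: contraNN ba => /eqP/val_inj->.
case/eqP: one0; apply/eqP; rewrite -oppr_eq0 -(IH _ ve' b (prv i)); try by rewrite /=; lia.
rewrite 2!entD entN IHe ?ent_step; try by rewrite /=; lia.
rewrite (negbTE ba) eqxx lbi eqxx subr0 add0r (_ : (prv i == i) = false) ?sub0r //.
by rewrite -val_eqE /=; lia.
Qed.

End Operators.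

(** * The model of the Nichols algebra *)

Section LinearSpan.
Variable F : fieldType.

(** The generators form a predicate, possibly with infinitely many witnesses (all words or trees of
    a degree), and membership is used by induction; no finite list has to be chosen. *)
Inductive lspan (V : lmodType F) (G : V -> Prop) : V -> Prop :=
| lspan0 : lspan G 0
| lspan_cons c g v : G g -> lspan G v -> lspan G (c *: g + v).

Variables (V W : lmodType F) (G : V -> Prop) (H : W -> Prop).

Lemma lspan_gen g : G g -> lspan G g.
Proof. by move=> h; rewrite -[g]scale1r -[_ *: _]addr0; apply: lspan_cons h (lspan0 _). Qed.

Lemma lspanD u v : lspan G u -> lspan G v -> lspan G (u + v).
Proof.
move=> hu hv; elim: hu => [|c g w hg _ IH]; first by rewrite add0r.
by rewrite -addrA; apply: lspan_cons.
Qed.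

Lemma lspanZ c v : lspan G v -> lspan G (c *: v).
Proof.
elim=> [|c' g w hg _ IH]; first by rewrite scaler0; apply: lspan0.
by rewrite scalerDr scalerA; apply: lspan_cons.
Qed.

Lemma lspan_sum I r (P : pred I) (f : I -> V) :
  (forall i, P i -> lspan G (f i)) -> lspan G (\sum_(i <- r | P i) f i).
Proof. by move=> h; apply: big_ind => //; [apply: lspan0 | apply: lspanD]. Qed.

Lemma lspan_map (f : {linear V -> W}) v :
  (forall g, G g -> lspan H (f g)) -> lspan G v -> lspan H (f v).
Proof.
move=> h; elim=> [|c g w hg _ IH]; first by rewrite linear0; apply: lspan0.
rewrite linearP; elim: (h _ hg) => [|c' g' w' hg' _ IH'].
  by rewrite scaler0 add0r.
by rewrite scalerDr scalerA -addrA; apply: lspan_cons.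
Qed.

End LinearSpan.

Lemma lspan_trans (F : fieldType) (V : lmodType F) (G H : V -> Prop) v :
  (forall g, G g -> lspan H g) -> lspan G v -> lspan H v.
Proof. by move=> h; apply: (@lspan_map F V V G H idfun). Qed.

(** * Homogeneity, defining relations and generation by the vector 1 *)

Section Model.
Variables (F : fieldType) (n p : nat) (q0 : F) (q : 'I_n -> 'I_n -> F).
Hypothesis prim : p.+2.-primitive_root q0.
Hypothesis q_diag : forall i, q i i = q0.
Hypothesis q_adj : forall i j : 'I_n, j = i.+1 :> nat -> q i j * q j i = q0^-1.
Hypothesis q_far : forall i j : 'I_n, (i.+1 < j)%N || (j.+1 < i)%N -> q i j * q j i = 1.
Implicit Types (e f : expo n p) (a b c i j k l : 'I_n).
Notation step := (step p).
Notation Rm := (Rm p q0 q).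
Notation Dm := (Dm p q0 q).
Notation Rm_Dm := (Rm_Dm prim q_diag q_adj q_far).

Definition esize e : nat := (\sum_l deg e l)%N.

Lemma deg0 l : deg (0 : expo n p) l = 0%N.
Proof. by apply: big1 => x _; rewrite ffunE. Qed.

Lemma deg_gt0 e a i l : (a <= l <= i)%N -> ent e a i != 0 -> (0 < deg e l)%N.
Proof.
move=> /andP[al li]; have ai := leq_trans al li; rewrite entE => h.
by rewrite /deg (bigD1 (exist _ (a, i) ai : pos_root n)) ?al //= addn_gt0 lt0n h.
Qed.

Lemma esizeS e f i : (forall l, deg f l = (deg e l + ((i == l) : nat))%N) ->
  esize f = (esize e).+1.
Proof.
move=> h; rewrite /esize (eq_bigr _ (fun l _ => h l)) big_split /= -addn1; congr (_ + _)%N.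
by rewrite (bigD1 i) //= eqxx big1 // => l li; rewrite eq_sym (negbTE li).
Qed.

Lemma esize0 e : esize e = 0%N -> e = 0.
Proof.
move=> /eqP; rewrite sum_nat_eq0 => /forallP h; apply: expoP => a i ai; rewrite ent0.
apply/eqP; apply: contraTT (h i) => eai /=.
by rewrite -lt0n (deg_gt0 _ eai) // ai leqnn.
Qed.

Lemma cf_Rm_neq0 (v : 'rV[F]_#|expo n p|) i f : cf (v *m Rm i) f != 0 ->
  exists e, cf v e != 0 /\ forall l, deg f l = (deg e l + ((i == l) : nat))%N.
Proof.
move=> h; suff [e [ve [a [ai ra ->]]]] : exists e, cf v e != 0 /\
    exists a, [/\ (a <= i)%N, rcoef q0 i a e != 0 & f = e + step a i].
  by exists e; split => // l; apply: (deg_rcoef prim ai ra).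
pose P e := [exists a : 'I_n, [&& (a <= i)%N, rcoef q0 i a e != 0 & f == e + step a i]].
have [/existsP[e /andP[ve /existsP[a /and3P[ai ra /eqP ->]]]]|/existsPn hn] :=
    boolP [exists e, (cf v e != 0) && P e].
  by exists e; split=> //; exists a.
case/eqP: h; rewrite mulmx_bas cf_sum big1 // => e _; rewrite cfZ bas_Rm cf_sum.
have := hn e; rewrite negb_and negbK => /orP[/eqP->|/existsPn ha]; first by rewrite mul0r.
rewrite big1 ?mulr0 // => a ai; rewrite cfZ cf_bas.
have := ha a; rewrite ai /= negb_and negbK => /orP[/eqP ra|fe].
  by rewrite /rtw ra mulr0 mul0r.
by rewrite eq_sym (negbTE fe) mulr0.
Qed.

Lemma cf_word w f : cf (bas F (0 : expo n p) *m wmx Rm w) f != 0 ->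
  forall l, deg f l = count_mem l w.
Proof.
elim/last_ind: w f => [|w i IH] f.
  by rewrite mulmx1 cf_bas; case: (0 =P f) => [<- _ l|_]; rewrite ?deg0 ?eqxx.
rewrite wmx_rcons mulmxA => /cf_Rm_neq0[e [/IH he hf]] l.
by rewrite hf he -cats1 count_cat /= addn0.
Qed.

Lemma cf_Rm0 (v : 'rV[F]_#|expo n p|) i : cf (v *m Rm i) 0 = 0.
Proof.
apply/eqP; apply: contraT => /cf_Rm_neq0[e [_ /(_ i)]].
by rewrite deg0 eqxx addn1.
Qed.

Lemma bas_Dm_ind i e (A : 'M[F]_#|expo n p|) :
  (forall f, esize e = (esize f).+1 -> bas F f *m A = 0) -> bas F e *m Dm i *m A = 0.
Proof.
move=> h; rewrite bas_Dm mulmx_suml big1 // => a ai; rewrite -scalemxAl.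
have [d0|dn] := eqVneq (dcoef q0 i a e) 0; first by rewrite /dtw d0 mul0r scale0r.
by rewrite h ?scaler0 //; apply: esizeS (deg_dcoef prim ai dn).
Qed.

(** By induction on the size of e, all D_k kill the image of [bas F e], since D_k lowers the size;
    that image is then a multiple of the vector 1, and the second hypothesis makes it 0. *)
Lemma Dm_intertwine_eq0 (C : 'M[F]_#|expo n p|) (c : 'I_n -> F) :
  (forall k, C *m Dm k = c k *: (Dm k *m C)) ->
  (forall v : 'rV_#|expo n p|, cf (v *m C) 0 = 0) -> C = 0.
Proof.
move=> hC h0; apply: bas_ext => e; rewrite mulmx0.
have [m] := ubnP (esize e); elim: m e => // m IH e em.
have hD k : bas F e *m C *m Dm k = 0.
  rewrite -mulmxA hC -scalemxAr mulmxA bas_Dm_ind ?scaler0 // => f ef.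
  by apply: IH; move: em; rewrite ef ltnS.
apply: cfP => f; rewrite cf0; apply/eqP; apply: contraT => hf.
by move: (hf); rewrite (Dm_kernel prim q_diag q_adj q_far hD hf) h0 eqxx.
Qed.

Lemma Rm2_Dm i j k : Rm i *m Rm j *m Dm k =
  (k == j)%:R *: Rm i + (q k j * (k == i)%:R) *: Rm j
  + (q k j * q k i) *: (Dm k *m (Rm i *m Rm j)).
Proof.
rewrite -[LHS]mulmxA Rm_Dm mulmxDr mul_mx_scalar -scalemxAr [Rm i *m (_ *m _)]mulmxA Rm_Dm.
rewrite mulmxDl mul_scalar_mx scalerDr scalerA addrA; congr (_ + _).
by rewrite -scalemxAl scalerA -mulmxA.
Qed.

(** The difference of the two sides skew-commutes with every D_k: the delta terms at k = i cancel
    directly, those at k = j because q_ij q_ji = 1. *)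
Lemma Rm_comm i j : (i.+1 < j)%N || (j.+1 < i)%N ->
  Rm i *m Rm j = q i j *: (Rm j *m Rm i).
Proof.
move=> ij; apply/eqP; rewrite -subr_eq0; apply/eqP.
have qij : q i j * q j i = 1 by apply: q_far.
apply: (@Dm_intertwine_eq0 _ (fun k => q k j * q k i)) => [k|v]; last first.
  rewrite mulmxBr -scalemxAr !mulmxA -[_ *: _]/(_ *: _) cfD -scaleN1r !cfZ !cf_Rm0.
  by rewrite !mulr0 addr0.
rewrite mulmxBl -scalemxAl !Rm2_Dm mulmxBr scalerBr -scalemxAr !scalerDr !scalerA.
have -> : q i j * (k == i)%:R = q k j * (k == i)%:R.
  by case: eqP => [->|]; rewrite ?mulr0.
have -> : q i j * (q k i * (k == j)%:R) = (k == j)%:R.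
  by case: eqP => [->|_]; rewrite ?mulr0 // mulr1.
have -> : q i j * (q k i * q k j) = q k j * q k i * q i j by ring.
have cancel (M : zmodType) (A B C D : M) : A + B + C - (B + A + D) = C - D.
  by rewrite [B + A]addrC opprD addrACA subrr add0r.
exact: cancel.
Qed.

(** The delta term carries the q-integer (m + 1)_q, which is 0 for m + 1 = N; this yields x_i^N =
    0. *)
Lemma Rm_pow_Dm i k m : wmx Rm (nseq m.+1 i) *m Dm k =
  ((k == i)%:R * \sum_(t < m.+1) q0 ^+ t) *: wmx Rm (nseq m i)
  + q k i ^+ m.+1 *: (Dm k *m wmx Rm (nseq m.+1 i)).
Proof.
elim: m => [|m IH].
  by rewrite /= !mulmx1 big_ord1 expr0 mulr1 expr1 Rm_Dm scalemx1.
rewrite [wmx Rm (nseq m.+2 i)]/= -/(wmx Rm (nseq m.+1 i)) -[LHS]mulmxA IH.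
rewrite mulmxDr -!scalemxAr [Rm i *m (Dm k *m _)]mulmxA Rm_Dm mulmxDl mul_scalar_mx scalerDr scalerA addrA.
rewrite -[Rm i *m wmx Rm (nseq m i)]/(wmx Rm (nseq m.+1 i)) -scalerDl.
congr (_ *: _ + _); last by rewrite -scalemxAl scalerA -exprSr -mulmxA.
case: eqP => [->|_]; last by rewrite !mul0r mulr0 addr0.
by rewrite !mul1r mulr1 [in RHS]big_ord_recr /= q_diag.
Qed.

Lemma Rm_pow i : wmx Rm (nseq p.+2 i) = 0.
Proof.
apply: (@Dm_intertwine_eq0 _ (fun k => q k i ^+ p.+2)) => [k|v]; last first.
  have -> : nseq p.+2 i = rcons (nseq p.+1 i) i by rewrite -cats1 -(nseqD p.+1 1) addn1.
  by rewrite wmx_rcons mulmxA cf_Rm0.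
rewrite Rm_pow_Dm (_ : \sum_(t < p.+2) _ = 0) ?mulr0 ?scale0r ?add0r //.
apply: (mulfI (q0_neq1 prim)); rewrite mulr0 -opprB mulNr -subrX1.
by rewrite (prim_expr_order prim) subrr oppr0.
Qed.

Lemma rcoef_neq0 i a e : (a <= i)%N -> ent e a i + 1 != 0 ->
  ((a < i)%N -> ent e a (prv i) != 0) -> rcoef q0 i a e != 0.
Proof.
move=> ai h1 h2; rewrite /rcoef !mulf_neq0 ?(ycoef_neq0 prim) ?invr_neq0 ?(q0_neq1 prim) //.
  by case: ltnP => [/h2->|_]; rewrite oner_neq0.
by rewrite subr_eq0 eq_sym -(qexp1 p q0) -(qexpD prim) (qexp_eq1 prim) addrC.
Qed.

Definition word_image e (v : 'rV[F]_#|expo n p|) :=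
  exists w, (forall l, count_mem l w = deg e l) /\ v = bas F (0 : expo n p) *m wmx Rm w.

(* Undoing a move in the least nonzero column reaches e by some R_i, up to a term with an entry in a smaller column. *)
Lemma bas_word_span e : lspan (word_image e) (bas F e).
Proof.
have [s] : exists s, esize e = s by exists (esize e).
elim: s e => [|s IHs] e es.
  by rewrite (esize0 es); apply: lspan_gen; exists [::]; split=> [l|]; rewrite ?deg0 ?mulmx1.
suff col m f : esize f = s.+1 -> (exists a i, [/\ (a <= i)%N, ent f a i != 0 & (i < m)%N]) ->
    lspan (word_image f) (bas F f).
  have [/existsP[a /existsP[i /andP[ai hai]]]|/existsPn h] :=
    boolP [exists a : 'I_n, [exists i : 'I_n, (a <= i)%N && (ent e a i != 0)]].
    by apply: (col n) => //; exists a, i.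
  have e0 : e = 0.
    apply: expoP => a i ai; rewrite ent0; apply/eqP.
    by have /existsPn/(_ i) := h a; rewrite ai /= negbK.
  by move: es; rewrite e0 /esize big1 // => l _; rewrite deg0.
elim: m f => [|m IHm] f fs; first by case=> a [i []].
case=> a [i [ai fai im]].
have [/existsP[b /existsP[j /and3P[bj hbj jm]]]|/existsPn h] :=
  boolP [exists b : 'I_n, [exists j : 'I_n, [&& (b <= j)%N, ent f b j != 0 & (j < m)%N]]].
  by apply: IHm => //; exists b, j.
have f0 b j : (b <= j)%N -> (j < i)%N -> ent f b j = 0.
  move=> bj ji; apply/eqP; have /existsPn/(_ j) := h b.
  by rewrite bj (leq_trans ji im) andbT negbK.
pose e0 := f - step a i.
have fE : f = e0 + step a i by rewrite subrK.
have e0prv b : (b < i)%N -> ent e0 b (prv i) = (a == b)%:R.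
  by move=> bi; rewrite ent_step_prv // f0 ?add0r //=; lia.
have r0 : rcoef q0 i a e0 != 0.
  apply: rcoef_neq0 => // [|lai]; last by rewrite e0prv // eqxx.
  by have := ent_step_same e0 ai ai; rewrite -fE eqxx mulr1n => <-.
have df := deg_rcoef prim ai r0; rewrite -fE in df.
have e0s : esize e0 = s by apply/eqP; rewrite -eqSS -fs (esizeS df).
have tw0 : rtw q0 q i a e0 != 0.
  by rewrite mulf_neq0 // (tw_neq0 prim q_diag q_adj q_far).
have hR : lspan (word_image f) (bas F e0 *m Rm i).
  apply: (@lspan_map _ _ _ (word_image e0) _ (mulmxr (Rm i))) (IHs _ e0s) => _ [w [hw ->]].
  apply: lspan_gen; exists (rcons w i); rewrite wmx_rcons mulmxA; split=> // l.
  by rewrite -cats1 count_cat hw /= addn0 df.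
have -> : bas F f = (rtw q0 q i a e0)^-1 *: (bas F e0 *m Rm i -
    \sum_(b < n | (b <= i)%N && (b != a)) rtw q0 q i b e0 *: bas F (e0 + step b i)).
  by rewrite bas_Rm (bigD1 a) //= addrK scalerA mulVf // scale1r -fE.
apply/lspanZ/lspanD => //; rewrite -scaleN1r; apply/lspanZ/lspan_sum => b /andP[bi ba].
(* In column i - 1 the only nonzero entry of [e0] is the one at row a. Hence a row b < i other than
   a has coefficient 0, and only b = i survives; its exponent keeps that entry in column i - 1, so
   the inner induction covers it. *)
have [rb|rb] := eqVneq (rcoef q0 i b e0) 0.
  by rewrite /rtw rb mulr0 scale0r; apply: lspan0.
have [lbi|ib] := ltnP b i.
  by move: rb; rewrite /rcoef lbi e0prv // [a == b]eq_sym (negbTE ba) eqxx /= !mul0r eqxx.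
have bE : b = i by apply: val_inj; apply/eqP; rewrite eqn_leq bi ib.
subst b; apply: lspanZ; have dg := deg_rcoef prim bi rb.
have lai : (a < i)%N by rewrite ltn_neqAle ai andbT; apply: contraNN ba => /eqP/val_inj->.
have dE l : deg (e0 + step i i) l = deg f l by rewrite dg df.
apply: (@lspan_trans _ _ (word_image (e0 + step i i))) => [_ [w [hw ->]]|].
  by apply: lspan_gen; exists w; split=> // l; rewrite hw dE.
apply: IHm; first by rewrite (esizeS dg) e0s.
exists a, (prv i); split; try by rewrite /=; lia.
rewrite entD e0prv // eqxx ent_step; last by rewrite /=; lia.
by rewrite [a == i]eq_sym (negbTE ba) addr0.
Qed.

Definition homog m (v : 'rV[F]_#|expo n p|) := forall e, cf v e != 0 -> esize e = m.

Lemma homog_word w : homog (size w) (bas F (0 : expo n p) *m wmx Rm w).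
Proof.
move=> e /cf_word he; rewrite /esize (eq_bigr _ (fun l _ => he l)).
elim: w {he} => [|i w IH] /=; first by rewrite big1.
rewrite big_split /= IH (bigD1 i) //= eqxx big1 // => l li.
by rewrite eq_sym (negbTE li).
Qed.

Lemma homog_Dm m v i : homog m.+1 v -> homog m (v *m Dm i).
Proof.
move=> hv f; rewrite cf_Dm => hf; apply/eqP; rewrite -eqSS.
have [/existsP[a /and3P[ai da va]]|/existsPn hn] := boolP [exists a : 'I_n,
   [&& (a <= i)%N, dcoef q0 i a (f + step a i) != 0 & cf v (f + step a i) != 0]].
  have := deg_dcoef prim ai da; rewrite addrK => /esizeS <-; apply/eqP; exact: hv.
case/eqP: hf; rewrite big1 // => a ai; have := hn a.
rewrite ai /= negb_and !negbK => /orP[/eqP h|/eqP->]; last by rewrite mulr0.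
by rewrite /dtw h !mul0r.
Qed.

(** Inductively every D_i kills v, so v is a multiple of the vector 1; in positive degree it is then
    0. *)
Lemma Dm_nondegenerate m v : homog m v ->
  (forall w, size w = m -> cf (v *m wmx Dm w) 0 = 0) -> v = 0.
Proof.
elim: m v => [|m IH] v hv h; apply: cfP => e; rewrite cf0;
  have [//|ve] := eqVneq (cf v e) 0.
  by have := h [::] erefl; rewrite mulmx1 -(esize0 (hv _ ve)).
have e0 : e = 0.
  apply: (Dm_kernel prim q_diag q_adj q_far) ve => i; apply: IH => [|w wm].
    exact: homog_Dm.
  by rewrite -mulmxA; apply: (h (i :: w)); rewrite /= wm.
by have := hv _ ve; rewrite e0 /esize big1 // => l _; rewrite deg0.
Qed.

End Model.

(** * The quantum symmetrizer *)

Section Symmetrizer.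
Variables (F : fieldType) (n : nat) (q : 'I_n -> 'I_n -> F).

Definition omega_entry k (v w : k.-tuple 'I_n) : F :=
  \sum_(s : 'S_k) qsym_coef q s w * (v == perm_word s w)%:R.

Lemma omegaE k (u : Tk F n k) v : omega q u v = \sum_w u w * omega_entry v w.
Proof.
rewrite /omega sum_ffunE; apply: eq_bigr => w _; rewrite sum_ffunE mulr_sumr.
by apply: eq_bigr => s _; rewrite !ffunE mulrA.
Qed.

Definition del k (p : 'I_k.+1) (w : k.+1.-tuple 'I_n) : k.-tuple 'I_n :=
  [tuple tnth w (lift p b) | b < k].

Lemma delE k (p : 'I_k.+1) (w : k.+1.-tuple 'I_n) :
  del p w = take p w ++ drop p.+1 w :> seq 'I_n.
Proof.
have pk := ltn_ord p; pose x := tnth w p; apply: (@eq_from_nth _ x) => [|b].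
  by rewrite size_cat size_takel ?size_drop !size_tuple //; lia.
rewrite size_tuple => bk; rewrite -[b]/(val (Ordinal bk)) -tnth_nth tnth_mktuple.
rewrite (tnth_nth x) nth_cat size_takel ?size_tuple ?(ltnW pk) //= /bump.
by case: leqP => pb; rewrite ?nth_take // nth_drop; congr nth; lia.
Qed.

Lemma rcons_del k (v : k.+1.-tuple 'I_n) :
  v = rcons (del ord_max v) (tnth v ord_max) :> seq 'I_n.
Proof.
rewrite delE drop_oversize ?size_tuple // cats0 (tnth_nth (tnth v ord_max)) /=.
by rewrite -take_nth ?size_tuple // take_oversize ?size_tuple.
Qed.

(** Permutations are sorted by the position p sent to the last place, to match a skew derivation
    that removes one letter of the word. *)
Lemma sum_lift_perm k (f : 'S_k.+1 -> F) :
  \sum_s f s = \sum_(p : 'I_k.+1) \sum_(s : 'S_k) f (lift_perm p ord_max s).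
Proof.
rewrite pair_big /=.
rewrite (reindex (fun x : 'I_k.+1 * 'S_k => lift_perm x.1 ord_max x.2)) //.
apply: onW_bij; apply: inj_card_bij => [[p s] [p' s'] /= h|]; last first.
  by rewrite card_prod card_ord !card_Sn.
have pp : p = p'.
  apply: (can_inj (permK (lift_perm p' ord_max s'))).
  by rewrite lift_perm_id -h lift_perm_id.
subst p'; congr pair; apply/permP => x; apply: (@lift_inj _ ord_max).
by rewrite -!(lift_perm_lift p) h.
Qed.

Lemma perm_word_lift k (p : 'I_k.+1) (s : 'S_k) (v w : k.+1.-tuple 'I_n) :
  (v == perm_word (lift_perm p ord_max s) w) =
  (tnth w p == tnth v ord_max) && (del ord_max v == perm_word s (del p w)).
Proof.
apply/eqP/andP => [->|[/eqP h1 /eqP h2]].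
  split; first by rewrite tnth_mktuple lift_permV lift_perm_id.
  apply/eqP/eq_from_tnth => b.
  by rewrite !tnth_mktuple lift_permV lift_perm_lift.
apply: eq_from_tnth => b; rewrite tnth_mktuple lift_permV.
case: (unliftP ord_max b) => [b'|] ->; last by rewrite lift_perm_id h1.
by rewrite lift_perm_lift -[LHS](tnth_mktuple (fun b => tnth v (lift ord_max b)))
  -/(del ord_max v) h2 !tnth_mktuple.
Qed.

Lemma ltn_lift k (p : 'I_k.+1) (a b : 'I_k) : (lift p a < lift p b)%N = (a < b)%N.
Proof. by rewrite /= /bump; lia. Qed.

(** As p goes to the maximum, the inversions involving p are exactly the pairs (p, b) with p < b. *)
Lemma qsym_lift k (p : 'I_k.+1) (s : 'S_k) (w : k.+1.-tuple 'I_n) :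
  qsym_coef q (lift_perm p ord_max s) w =
  (\prod_(b < k.+1 | (p < b)%N) q (tnth w p) (tnth w b)) * qsym_coef q s (del p w).
Proof.
rewrite /qsym_coef (bigD1_ord p) //=; congr (_ * _).
  apply: eq_bigl => b; rewrite lift_perm_id andbC.
  case: (unliftP p b) => [b'|] ->; last by rewrite ltnn andbF.
  by rewrite lift_perm_lift lift_max ltn_ord.
apply: eq_bigr => a _; rewrite big_mkcond (bigD1_ord p) // lift_perm_id lift_perm_lift.
have -> : (@ord_max k < lift ord_max (s a))%N = false.
  by rewrite lift_max ltnNge ltnW ?ltn_ord.
rewrite andbF -[RHS]mul1r; congr (_ * _); rewrite [RHS]big_mkcond; apply: eq_bigr => b _.
by rewrite !lift_perm_lift !tnth_mktuple !ltn_lift.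
Qed.

Lemma omega_entryS k (v w : k.+1.-tuple 'I_n) :
  omega_entry v w = \sum_(p < k.+1)
    ((tnth w p == tnth v ord_max)%:R *
     \prod_(b < k.+1 | (p < b)%N) q (tnth w p) (tnth w b)) *
    omega_entry (del ord_max v) (del p w).
Proof.
rewrite /omega_entry sum_lift_perm; apply: eq_bigr => p _; rewrite mulr_sumr.
apply: eq_bigr => s _; rewrite qsym_lift perm_word_lift -mulnb natrM; ring.
Qed.

Lemma omega_entry0 (v w : 0.-tuple 'I_n) : omega_entry v w = 1.
Proof.
rewrite /omega_entry (big_pred1 1%g) => [|s]; last first.
  by apply/esym/eqP/permP; case.
rewrite /qsym_coef big_ord0 mul1r (_ : v == _) //.
by apply/eqP; rewrite [LHS]tuple0 [RHS]tuple0.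
Qed.

End Symmetrizer.

(** * The kernel of the quantum symmetrizer is the kernel of evaluation in the model *)

Section Identification.
Variables (F : fieldType) (n p : nat) (q0 : F) (q : 'I_n -> 'I_n -> F).
Hypothesis prim : p.+2.-primitive_root q0.
Hypothesis q_diag : forall i, q i i = q0.
Hypothesis q_adj : forall i j : 'I_n, j = i.+1 :> nat -> q i j * q j i = q0^-1.
Hypothesis q_far : forall i j : 'I_n, (i.+1 < j)%N || (j.+1 < i)%N -> q i j * q j i = 1.
Notation Rm := (Rm p q0 q).
Notation Dm := (Dm p q0 q).
Notation vac := (bas F (0 : expo n p)).

Lemma vac_Dm k : vac *m Dm k = 0.
Proof.
apply: cfP => f; rewrite cf0; apply/eqP; apply: contraT; rewrite cf_Dm => h.
case/eqP: h; apply: big1 => a ak; rewrite cf_bas.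
case: eqP => [fa|]; last by rewrite mulr0.
have [d0|dn] := eqVneq (dcoef q0 k a (f + step p a k)) 0; first by rewrite /dtw d0 !mul0r.
by have := deg_dcoef prim ak dn k; rewrite -fa deg0 eqxx addn1.
Qed.

(** Iterated Leibniz rule: D_k meets the last letter first, so removing the letter at x costs one
    factor of q for each letter to its right. *)
Lemma word_Dm_seq k (w : seq 'I_n) : vac *m wmx Rm w *m Dm k =
  \sum_(x < size w) ((nth k w x == k)%:R * \prod_(x.+1 <= b < size w) q k (nth k w b))
    *: (vac *m wmx Rm (take x w ++ drop x.+1 w)).
Proof.
elim/last_ind: w => [|w i IH]; first by rewrite big_ord0 mulmx1 vac_Dm.
rewrite wmx_rcons mulmxA -mulmxA (Rm_Dm prim q_diag q_adj q_far) mulmxDr mul_mx_scalar.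
rewrite -scalemxAr [vac *m _ *m (Dm k *m _)]mulmxA IH.
rewrite size_rcons big_ord_recr /= addrC; congr (_ + _); last first.
  rewrite mulmx_suml scaler_sumr; apply: eq_bigr => x _.
  rewrite -scalemxAl scalerA -mulmxA -wmx_rcons.
  have xw := ltn_ord x.
  rewrite nth_rcons xw big_nat_recr //= nth_rcons ltnn eqxx.
  have -> : take x (rcons w i) ++ drop x.+1 (rcons w i) = rcons (take x w ++ drop x.+1 w) i.
    by rewrite -!cats1 takel_cat ?(ltnW xw) // drop_cat -catA; case: ltnP => // h;
      rewrite [drop _ w]drop_oversize // (_ : (x.+1 - size w)%N = 0%N) ?drop0 //; lia.
  congr (_ *: _); rewrite mulrC -mulrA; congr (_ * (_ * _)).
  by apply: eq_big_nat => b /andP[_ bw]; rewrite -cats1 nth_cat bw.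
rewrite nth_rcons ltnn eqxx big_geq // mulr1 eq_sym.
by rewrite -cats1 take_size_cat // drop_oversize ?cats0 // size_cat addn1.
Qed.

Lemma word_Dm m k (w : m.+1.-tuple 'I_n) : vac *m wmx Rm w *m Dm k =
  \sum_(x < m.+1) ((tnth w x == k)%:R * \prod_(b < m.+1 | (x < b)%N) q (tnth w x) (tnth w b))
    *: (vac *m wmx Rm (del x w)).
Proof.
rewrite word_Dm_seq size_tuple; apply: eq_bigr => x _.
rewrite delE (tnth_nth k); congr (_ *: _); case: eqP => [->|_]; last by rewrite !mul0r.
by rewrite big_geq_mkord; congr (_ * _); apply: eq_bigr => b _; rewrite (tnth_nth k).
Qed.

(** Both sides obey the same recursion on the last letter of v. That letter is derived first, whence
    [rev v]. *)
Lemma omega_entry_cf m (v w : m.-tuple 'I_n) :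
  omega_entry q v w = cf (vac *m wmx Rm w *m wmx Dm (rev v)) 0.
Proof.
elim: m v w => [|m IH] v w.
  by rewrite omega_entry0 (tuple0 v) (tuple0 w) /= !mulmx1 cf_bas eqxx.
rewrite (rcons_del v) rev_rcons /= mulmxA word_Dm mulmx_suml cf_sum omega_entryS.
by apply: eq_bigr => x _; rewrite -scalemxAl cfZ IH.
Qed.

Definition Phi k (u : Tk F n k) : 'rV[F]_#|expo n p| :=
  \sum_(w : k.-tuple 'I_n) u w *: (vac *m wmx Rm w).

Lemma omega_cf k (u : Tk F n k) v : omega q u v = cf (Phi u *m wmx Dm (rev v)) 0.
Proof.
rewrite omegaE mulmx_suml cf_sum; apply: eq_bigr => w _.
by rewrite -scalemxAl cfZ omega_entry_cf.
Qed.

(** The coordinates of [omega q u] are exactly the vacuum coefficients by which [Dm_nondegenerate]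
    tests [Phi u]. *)
Lemma omega_eq0 k (u : Tk F n k) : (omega q u == 0) = (Phi u == 0).
Proof.
apply/eqP/eqP => [h|h]; last first.
  by apply/ffunP => v; rewrite omega_cf h mul0mx cf0 ffunE.
apply: (@Dm_nondegenerate _ _ _ _ _ prim q_diag q_adj q_far k) => [e|w wk].
  rewrite cf_sum => he; have [/existsP[w hw]|/existsPn hn] :=
    boolP [exists w : k.-tuple 'I_n, cf (vac *m wmx Rm w) e != 0].
    by rewrite (homog_word prim hw) size_tuple.
  case/eqP: he; apply: big1 => w _; have := hn w; rewrite negbK cfZ => /eqP->.
  by rewrite mulr0.
have rk : size (rev w) == k by rewrite size_rev wk.
by rewrite -[w]revK -[rev w]/(val (Tuple rk)) -omega_cf h ffunE.
Qed.

Fact omega_linear k : linear (@omega F n q k).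
Proof.
move=> c u v; apply/ffunP => x; rewrite !ffunE !omegaE scaler_sumr -big_split.
by apply: eq_bigr => w _; rewrite !ffunE mulrDl -mulrA.
Qed.

Fact Phi_linear k : linear (@Phi k).
Proof.
move=> c u v; rewrite scaler_sumr -big_split.
by apply: eq_bigr => w _; rewrite !ffunE scalerDl scalerA.
Qed.

HB.instance Definition _ k := GRing.isLinear.Build F (Tk F n k) (Tk F n k) _ _ (@omega_linear k).
HB.instance Definition _ k := GRing.isLinear.Build F (Tk F n k) _ _ _ (@Phi_linear k).

(** Rank-nullity on the span of s: two linear maps with the same kernel have images of equal
    dimension. *)
Lemma dim_omega_span k (s : seq (Tk F n k)) :
  \dim (span [seq omega q u | u <- s]) = \dim (span [seq Phi u | u <- s]).
Proof.
have hf : [seq omega q u | u <- s] = [seq linfun (@omega F n q k) u | u <- s].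
  by apply: eq_map => u; rewrite lfunE.
have hg : [seq Phi u | u <- s] = [seq linfun (@Phi k) u | u <- s].
  by apply: eq_map => u; rewrite lfunE.
rewrite hf hg -!limg_span.
have kerE : lker (linfun (@omega F n q k)) = lker (linfun (@Phi k)).
  by apply/vspaceP => u; rewrite !memv_ker !lfunE; apply: omega_eq0.
apply/eqP; rewrite -(eqn_add2l (\dim (span s :&: lker (linfun (@omega F n q k))))).
by rewrite limg_ker_dim kerE limg_ker_dim.
Qed.

End Identification.

(** * The braided Lie algebra of connected words *)

Section Connected.
Variable n : nat.
Implicit Types (P Q : pred 'I_n) (i j k : 'I_n).

Definition conn P : bool :=
  [exists i, P i] && [forall i : 'I_n, forall j : 'I_n, forall k : 'I_n,
    (i < j < k)%N ==> P i ==> P k ==> P j].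

Lemma connP P : reflect ((exists i, P i) /\
  forall i j k, (i < j < k)%N -> P i -> P k -> P j) (conn P).
Proof.
apply: (iffP andP) => [[/existsP h1 /forallP h2]|[[i Pi] h]]; split=> //.
- move=> i j k ijk Pi Pk; have /forallP/(_ j)/forallP/(_ k) := h2 i.
  by rewrite ijk Pi Pk.
- by apply/existsP; exists i.
do 3!apply/forallP => ?; do 3!apply/implyP => ?; apply: h; eauto.
Qed.

Lemma eq_conn P Q : P =1 Q -> conn P = conn Q.
Proof.
move=> PQ; rewrite /conn (eq_existsb PQ); congr (_ && _).
by do 3!apply: eq_forallb => ?; rewrite !PQ.
Qed.

Definition cword (w : seq 'I_n) := conn (fun i => i \in w).

Lemma eq_cword (u v : seq 'I_n) : u =i v -> cword u = cword v.
Proof. by move=> uv; apply: eq_conn => i; apply: uv. Qed.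

Lemma cword_size (u : seq 'I_n) : cword u -> (0 < size u)%N.
Proof. by case/connP => -[i]; case: u. Qed.

Lemma cword1 i : cword [:: i].
Proof.
apply/connP; split; first by exists i; rewrite inE.
by move=> a b c abc; rewrite !inE => /eqP ai /eqP ci; move: abc; rewrite ai ci; lia.
Qed.

Lemma cword_adj i j : (j = i.+1 :> nat) \/ (i = j.+1 :> nat) -> cword [:: i; j].
Proof.
move=> h; apply/connP; split; first by exists i; rewrite inE eqxx.
by move=> a b c abc; rewrite !inE => /orP[] /eqP ai /orP[] /eqP ci;
  move: abc; rewrite ai ci; lia.
Qed.

Lemma cword_nseq (k : nat) i : cword (nseq k.+1 i).
Proof.
by rewrite (@eq_cword _ [:: i]) ?cword1 // => x; rewrite mem_nseq inE.
Qed.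

(** Leading letters are dropped while x and y both still occur in the rest; the first letter that
    cannot be dropped is x or y, and the next occurrence of the other one closes the pair. *)
Lemma split_pair (x y : 'I_n) (A : seq 'I_n) : x != y -> x \in A -> y \in A ->
  exists (a m b : seq 'I_n) (s t : 'I_n), [/\ A = a ++ s :: m ++ t :: b,
    (s = x /\ t = y) \/ (s = y /\ t = x), x \notin m & y \notin m].
Proof.
have first_occ (s : 'I_n) B : s \in B -> exists m b, B = m ++ s :: b /\ s \notin m.
  elim: B => //= c B IHB; have [->|cs] := eqVneq s c; first by exists [::], B.
  rewrite inE (negbTE cs) => /IHB[m [b [-> sm]]]; exists (c :: m), b; split=> //.
  by rewrite inE negb_or cs.
move=> xy; elim: A => // c A IHA; rewrite !inE.
have [/andP[xA yA] _ _|] := boolP ((x \in A) && (y \in A)).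
  have [a [m [b [s [t [-> h1 h2 h3]]]]]] := IHA xA yA.
  by exists (c :: a), m, b, s, t.
rewrite negb_and => /orP[xA|yA].
  rewrite (negbTE xA) orbF => /eqP xc; subst c; rewrite eq_sym (negbTE xy) /=.
  move=> /first_occ[m [b [AE ym]]]; exists [::], m, b, x, y; rewrite AE; split=> //; first by left.
  by move: xA; rewrite AE mem_cat negb_or => /andP[].
rewrite (negbTE yA) orbF => + /eqP yc; subst c; rewrite (negbTE xy) /=.
move=> /first_occ[m [b [AE ym]]]; exists [::], m, b, y, x; rewrite AE; split=> //; first by right.
by move: yA; rewrite AE mem_cat negb_or => /andP[].
Qed.

End Connected.

Section Bicharacter.
Variables (F : fieldType) (n : nat) (q : 'I_n -> 'I_n -> F).

Definition wdeg (w : seq 'I_n) i : nat := count_mem i w.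
Definition cw (u v : seq 'I_n) : F := \prod_(i <- u) \prod_(j <- v) q i j.

Lemma eq_chi (a a' b b' : 'I_n -> nat) : a =1 a' -> b =1 b' -> chi q a b = chi q a' b'.
Proof.
by move=> aa bb; apply: eq_bigr => i _; apply: eq_bigr => j _; rewrite aa bb.
Qed.

Lemma chiDl (a a' b : 'I_n -> nat) :
  chi q (fun i => (a i + a' i)%N) b = chi q a b * chi q a' b.
Proof.
rewrite /chi -big_split; apply: eq_bigr => i _; rewrite -big_split.
by apply: eq_bigr => j _; rewrite mulnDl exprD.
Qed.

Lemma chiDr (a b b' : 'I_n -> nat) :
  chi q a (fun i => (b i + b' i)%N) = chi q a b * chi q a b'.
Proof.
rewrite /chi -big_split; apply: eq_bigr => i _; rewrite -big_split.
by apply: eq_bigr => j _; rewrite mulnDr exprD.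
Qed.

Lemma prod_count (G : 'I_n -> F) w : \prod_(i <- w) G i = \prod_i G i ^+ count_mem i w.
Proof.
elim: w => [|x w IH]; first by rewrite big_nil big1.
rewrite big_cons IH; under [RHS]eq_bigr => i _ do rewrite /= exprD.
rewrite big_split /=; congr (_ * _); rewrite (bigD1 x) //= eqxx expr1.
by rewrite big1 ?mulr1 // => i ix; rewrite eq_sym (negbTE ix).
Qed.

Lemma chi_wdeg u v : chi q (wdeg u) (wdeg v) = cw u v.
Proof.
rewrite /cw prod_count; apply: eq_bigr => i _; rewrite prod_count -prodrXl.
by apply: eq_bigr => j _; rewrite -exprM mulnC.
Qed.

Lemma chi_leaf i j : chi q (bdeg (BLeaf i)) (bdeg (BLeaf j)) = q i j.
Proof.
rewrite (@eq_chi _ (wdeg [:: i]) _ (wdeg [:: j])) ?chi_wdeg /cw ?big_seq1 //;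
  by move=> x; rewrite /wdeg /= addn0.
Qed.

End Bicharacter.

(** * Brackets in any matrix algebra satisfying the two relations *)

Section BraidedLie.
Variables (F : fieldType) (n d N : nat) (q0 : F) (q : 'I_n -> 'I_n -> F).
Variable X : 'I_n -> 'M[F]_d.
Definition far (i j : 'I_n) := (i.+1 < j)%N || (j.+1 < i)%N.
Hypothesis N_gt1 : (1 < N)%N.
Hypothesis prim : N.-primitive_root q0.
Hypothesis q_neq0 : forall i j, q i j != 0.
Hypothesis q_diag : forall i, q i i = q0.
Hypothesis q_adj : forall i j : 'I_n, j = i.+1 :> nat -> q i j * q j i = q0^-1.
Hypothesis q_far : forall i j : 'I_n, far i j -> q i j * q j i = 1.
Hypothesis X_comm : forall i j, far i j -> X i *m X j = q i j *: (X j *m X i).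
Hypothesis X_pow : forall i, wmx X (nseq N i) = 0.
Implicit Types (u v w z : seq 'I_n) (i j k l : 'I_n) (t : btree 'I_n).
Notation wm := (wmx X).
Notation cw := (cw q).
Notation chi := (chi q).

Fixpoint tmx t : 'M[F]_d :=
  match t with
  | BLeaf i => X i
  | BNode a b => tmx b *m tmx a - chi (bdeg b) (bdeg a) *: (tmx a *m tmx b)
  end.

(** Kept separate by degree, so that the scalar in the bracket is constant on each piece and the
    bracket extends bilinearly. *)
Definition lie (a : 'I_n -> nat) : 'M[F]_d -> Prop :=
  lspan (fun M => exists t, bdeg t =1 a /\ M = tmx t).

Lemma lie_tmx t : lie (bdeg t) (tmx t).
Proof. by apply: lspan_gen; exists t. Qed.

Lemma lie_ext a b M : a =1 b -> lie a M -> lie b M.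
Proof.
move=> ab; apply: lspan_trans => _ [t [ht ->]]; apply: lspan_gen.
by exists t; split=> // i; rewrite ht ab.
Qed.

Lemma lie_bracket a b A B : lie a A -> lie b B ->
  lie (fun i => (a i + b i)%N) (B *m A - chi b a *: (A *m B)).
Proof.
move=> hA hB; elim: hA => [|c _ A' [t [ht ->]] _ IH].
  by rewrite mulmx0 mul0mx scaler0 subr0; apply: lspan0.
rewrite mulmxDr mulmxDl scalerDr -scalemxAr -scalemxAl scalerA mulrC -scalerA.
rewrite opprD addrACA -scalerBr; apply: lspanD => //; apply: lspanZ => {IH}.
elim: hB => [|c' _ B' [s [hs ->]] _ IH].
  by rewrite mulmx0 mul0mx scaler0 subr0; apply: lspan0.
rewrite mulmxDr mulmxDl scalerDr -scalemxAr -scalemxAl scalerA mulrC -scalerA.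
rewrite opprD addrACA -scalerBr; apply: lspanD => //; apply: lspanZ.
apply: lspan_gen; exists (BNode t s); split=> [i|] /=; first by rewrite ht hs.
by rewrite (eq_chi q hs ht).
Qed.

(** One-directional, since c may be 0; membership in [lie] is transported from v to u only. *)
Definition sim u v := exists c, wm u = c *: wm v.

Lemma sim_refl u : sim u u. Proof. by exists 1; rewrite scale1r. Qed.

Lemma sim_trans v u w : sim u v -> sim v w -> sim u w.
Proof. by move=> [c hc] [c' hc']; exists (c * c'); rewrite hc hc' scalerA. Qed.

Lemma sim_cat a b u v : sim u v -> sim (a ++ u ++ b) (a ++ v ++ b).
Proof.
by move=> [c hc]; exists c; rewrite !wmx_cat hc -scalemxAl -scalemxAr.
Qed.

Lemma sim_cat2 u u' v v' : sim u u' -> sim v v' -> sim (u ++ v) (u' ++ v').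
Proof.
move=> h1 h2; apply: (@sim_trans (u' ++ v)); first exact: (sim_cat [::] v h1).
by have := sim_cat u' [::] h2; rewrite !cats0.
Qed.

Lemma far_sym i j : far i j = far j i. Proof. exact: orbC. Qed.

Lemma sim_pass i v : all (far i) v -> sim (i :: v) (rcons v i).
Proof.
elim: v => [_|j v IH /= /andP[ij /IH h]]; first exact: sim_refl.
apply: (@sim_trans (j :: i :: v)).
  by exists (q i j); rewrite /= !mulmxA X_comm // -scalemxAl.
exact: (sim_cat2 (sim_refl [:: j]) h).
Qed.

Lemma sim_pass_left i v : all (far i) v -> sim (rcons v i) (i :: v).
Proof.
elim: v => [_|j v IH /= /andP[ij /IH h]]; first exact: sim_refl.
apply: (@sim_trans (j :: i :: v)); first exact: (sim_cat2 (sim_refl [:: j]) h).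
by exists (q j i); rewrite /= !mulmxA X_comm 1?far_sym // -scalemxAl.
Qed.

Lemma sim_filter (P : pred 'I_n) v :
  (forall x y, x \in v -> y \in v -> P x -> ~~ P y -> far x y) ->
  sim v (filter P v ++ filter (predC P) v).
Proof.
elim: v => [_|x v IH h] /=; first exact: sim_refl.
have {}IH : sim v (filter P v ++ filter (predC P) v).
  by apply: IH => a b av bv; apply: h; rewrite inE ?av ?bv orbT.
case: ifP => Px /=; first exact: (sim_cat2 (sim_refl [:: x]) IH).
apply: (sim_trans (sim_cat2 (sim_refl [:: x]) IH)).
rewrite -cat_rcons; apply: (@sim_cat2 (x :: filter P v) (rcons (filter P v) x) (filter (predC P) v)); last exact: sim_refl.
apply: sim_pass; apply/allP => y; rewrite mem_filter => /andP[Py yv].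
by rewrite far_sym; apply: h; rewrite ?inE ?eqxx ?yv ?orbT // Px.
Qed.

Lemma cw_catl u u' v : cw (u ++ u') v = cw u v * cw u' v.
Proof. exact: big_cat. Qed.

Lemma cw_catr u v v' : cw u (v ++ v') = cw u v * cw u v'.
Proof. by rewrite /cw -big_split; apply: eq_bigr => i _; rewrite big_cat. Qed.

Lemma cw_consr i j v : cw [:: i] (j :: v) = q i j * cw [:: i] v.
Proof. by rewrite /cw !big_seq1 big_cons. Qed.

Lemma cw_consl i j v : cw (j :: v) [:: i] = q j i * cw v [:: i].
Proof. by rewrite /cw big_cons big_seq1. Qed.

Lemma cw_neq0 u v : cw u v != 0.
Proof. by rewrite /cw prodf_seq_neq0; apply/allP => i _; rewrite /= prodf_seq_neq0; apply/allP => j _ /=. Qed.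

Lemma cw1_far i v : all (far i) v -> cw [:: i] v * cw v [:: i] = 1.
Proof.
elim: v => [_|j v IH /= /andP[ij /IH h]]; first by rewrite /cw !big_seq1 !big_nil mulr1.
by rewrite cw_consr cw_consl mulrACA h q_far // mulr1.
Qed.

Lemma cw_nseq_sym m i v :
  cw (nseq m i) v * cw v (nseq m i) = (cw [:: i] v * cw v [:: i]) ^+ m.
Proof.
elim: m => [|m IH].
  rewrite expr0 /cw big_nil mul1r; apply: big1 => j _; exact: big_nil.
by rewrite exprS -IH -[nseq m.+1 i]/([:: i] ++ nseq m i) cw_catl cw_catr mulrACA.
Qed.

Lemma q0_inv_neq1 : q0^-1 != 1.
Proof.
rewrite invr_eq1; apply: contraTneq N_gt1 => h.
by have := prim_order_dvd prim 1; rewrite h expr1n eqxx => /dvdn_leq; rewrite -leqNgt; apply.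
Qed.

Section InductionStep.
Variable z0 : seq 'I_n.
Hypothesis IH : forall u, (size u < size z0)%N -> cword u -> lie (wdeg u) (wm u).
Notation good z := (lie (wdeg z0) (wm z)).

Lemma good_sim u v : sim u v -> good v -> good u.
Proof. by move=> [c ->]; apply: lspanZ. Qed.

Lemma good_brk u v : perm_eq (u ++ v) z0 -> cword u -> cword v ->
  lie (wdeg z0) (wm (v ++ u) - cw v u *: wm (u ++ v)).
Proof.
move=> uvz cu cv; have sz : size z0 = (size u + size v)%N by rewrite -(perm_size uvz) size_cat.
have u0 := cword_size cu; have v0 := cword_size cv.
rewrite !wmx_cat -chi_wdeg.
apply: (@lie_ext (fun i => (wdeg u i + wdeg v i)%N)).
  by move=> i; rewrite /wdeg -(seq.permP uvz) count_cat.
by apply: lie_bracket; apply: IH => //; lia.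
Qed.

Lemma good_rot u v : perm_eq (u ++ v) z0 -> cword u -> cword v ->
  good (u ++ v) -> good (v ++ u).
Proof.
move=> h cu cv g; rewrite -[wm (v ++ u)](subrK (cw v u *: wm (u ++ v))).
by apply: lspanD; [apply: good_brk | apply: lspanZ].
Qed.

Lemma lie_scale_inv a c M : c != 0 -> lie a (c *: M) -> lie a M.
Proof. by move=> c0 h; rewrite -[M]scale1r -(mulVf c0) -scalerA; apply: lspanZ. Qed.

(* Both [u, v] and [v, u] lie in L; they are independent combinations of uv and vu unless the symmetrized character is 1. *)
Lemma good_two_brackets u v : perm_eq (u ++ v) z0 -> cword u -> cword v ->
  cw u v * cw v u != 1 -> good (u ++ v).
Proof.
move=> h cu cv c1; have h' : perm_eq (v ++ u) z0 by rewrite perm_catC.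
apply: (@lie_scale_inv _ (1 - cw u v * cw v u)); first by rewrite subr_eq0 eq_sym.
have -> : (1 - cw u v * cw v u) *: wm (u ++ v) = (wm (u ++ v) - cw u v *: wm (v ++ u))
    + cw u v *: (wm (v ++ u) - cw v u *: wm (u ++ v)).
  by rewrite scalerBr addrA subrK scalerBl scale1r scalerA.
by apply: lspanD; [apply: good_brk | apply/lspanZ/good_brk].
Qed.

Definition rotatable i := forall v, perm_eq (i :: v) z0 -> cword v.

Lemma good_rot_word u v : {in u, forall i, rotatable i} -> perm_eq (u ++ v) z0 ->
  good (u ++ v) <-> good (v ++ u).
Proof.
elim: u v => [|i u IHu] v hu h; first by rewrite cats0.
have hp : perm_eq (u ++ (v ++ [:: i])) z0.
  by rewrite -(perm_rcons i) -cats1 -catA in h.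
have hi : cword (u ++ v) by apply: hu h; rewrite inE eqxx.
rewrite -cat_rcons -cats1 -IHu //; last by move=> x xu; apply: hu; rewrite inE xu orbT.
rewrite catA -[(i :: u) ++ v]/([:: i] ++ (u ++ v)).
split; apply: good_rot => //; rewrite ?cword1 //.
by rewrite -catA.
Qed.

(* Moving i and j past v one at a time or both at once gives two scalars of ratio q_ij q_ji, which differs from 1. *)
Lemma good_pair i j v : rotatable i -> rotatable j -> q i j * q j i = q0^-1 ->
  cword [:: i; j] -> perm_eq (i :: j :: v) z0 -> (v != [::] -> cword v) ->
  good (i :: j :: v).
Proof.
move=> ri rj qij cij h cv.
have [v0|vn] := eqVneq v [::].
  subst v; apply: (@good_two_brackets [:: i] [:: j]); rewrite ?cword1 //.
  by rewrite /cw !big_seq1 qij q0_inv_neq1.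
have {}cv := cv vn.
have h1 : perm_eq ((j :: v) ++ [:: i]) z0 by rewrite cats1 perm_rcons.
have h2 : perm_eq ((v ++ [:: i]) ++ [:: j]) z0.
  by rewrite cats1 perm_rcons -[j :: v ++ [:: i]]/((j :: v) ++ [:: i]).
have h3 : perm_eq (v ++ [:: i; j]) z0 by rewrite perm_catC.
have b1 := good_brk h1 (ri _ h) (cword1 i).
have b2 := good_brk h2 (rj (v ++ [:: i]) _) (cword1 j).
have {}b2 := b2 h1.
have b3 := good_brk h3 cv cij.
have hc : cw [:: i] (j :: v) * cw [:: j] (v ++ [:: i]) = q0^-1 * cw [:: i; j] v.
  rewrite cw_consr cw_catr -[[:: i; j]]/([:: i] ++ [:: j]) cw_catl.
  by rewrite [cw [:: j] [:: i]]big_seq1 big_seq1 -qij; ring.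
have g : good (v ++ [:: i; j]).
  apply: (@lie_scale_inv _ (cw [:: i; j] v * (1 - q0^-1))).
    by rewrite mulf_neq0 ?cw_neq0 // subr_eq0 eq_sym q0_inv_neq1.
  have -> : (cw [:: i; j] v * (1 - q0^-1)) *: wm (v ++ [:: i; j]) =
     (wm ([:: i] ++ j :: v) - cw [:: i] (j :: v) *: wm ((j :: v) ++ [:: i]))
     + cw [:: i] (j :: v) *: (wm ([:: j] ++ v ++ [:: i]) -
        cw [:: j] (v ++ [:: i]) *: wm ((v ++ [:: i]) ++ [:: j]))
     - (wm ([:: i; j] ++ v) - cw [:: i; j] v *: wm (v ++ [:: i; j])).
    rewrite scalerBr scalerA hc -catA /= addrA subrK opprB.
    by rewrite [RHS]addrC addrA subrK mulrBr mulr1 scalerBl mulrC.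
  apply: lspanD; first by apply: lspanD => //; apply: lspanZ.
  by rewrite -scaleN1r; apply: lspanZ.
rewrite -[wm _](subrK (cw [:: i; j] v *: wm (v ++ [:: i; j]))).
by apply: lspanD => //; apply: lspanZ.
Qed.

(** Deleting one copy of i opens a gap only if it was the sole copy and lay strictly between two
    other letters. *)
Lemma rotatableP i : cword z0 -> (exists2 x, x \in z0 & x != i) ->
  [\/ forall x, x \in z0 -> (i <= x)%N, forall x, x \in z0 -> (x <= i)%N
    | (1 < count_mem i z0)%N] -> rotatable i.
Proof.
move=> /connP[_ cz] [x xz xi] hi v h; have hm := perm_mem h.
apply/connP; split.
  by exists x; move: xz; rewrite -hm inE (negbTE xi).
move=> a b c abc av cv.
have az : a \in z0 by rewrite -hm inE av orbT.
have cz' : c \in z0 by rewrite -hm inE cv orbT.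
have := cz _ _ _ abc az cz'; rewrite -hm inE => /orP[/eqP bi|//].
subst b; case: hi => [/(_ _ az)|/(_ _ cz')|]; try by clear -abc; lia.
by rewrite -(seq.permP h) /= eqxx add1n ltnS -has_count has_pred1.
Qed.

(** Between nearest occurrences of l and l+1 all letters exceed l+1, so l slides past them up to a
    scalar and meets l+1. Rotating the preceding letters of A to the back brings the pair to the
    front, where [good_pair] applies. *)
Lemma good_pair_mem l l1 A Y : l1 = l.+1 :> nat -> {in A, forall i, rotatable i} ->
  l \in A -> l1 \in A -> (forall x, x \in A -> (l <= x)%N) ->
  (forall v, perm_eq (l :: l1 :: v) z0 -> v != [::] -> cword v) ->
  perm_eq (A ++ Y) z0 -> good (A ++ Y).
Proof.
move=> ll1 rA lA l1A lmin hv h.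
have neq : l != l1 by rewrite -val_eqE /= ll1 neq_ltn ltnSn.
have [a [m [b [s [t [AE st lm l1m]]]]]] := split_pair neq lA l1A.
have ra : {in a, forall i, rotatable i} by move=> i ia; apply: rA; rewrite AE mem_cat ia.
have rm : {in m, forall i, rotatable i}.
  by move=> i im; apply: rA; rewrite AE mem_cat inE mem_cat im !orbT.
have fm : all (far l) m.
  apply/allP => x xm; have xA : x \in A by rewrite AE mem_cat inE mem_cat xm !orbT.
  have := lmin _ xA; rewrite leq_eqVlt => /orP[/eqP/val_inj lx|lx].
    by rewrite lx xm in lm.
  have : x != l1 by apply: contraNneq l1m => <-.
  by rewrite /far -val_eqE /= ll1; clear -lx; lia.
have qq : q l l1 * q l1 l = q0^-1 by rewrite q_adj.
have qq' : q l1 l * q l l1 = q0^-1 by rewrite mulrC.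
pose T := b ++ Y ++ a.
have h1 P : count P (s :: m ++ t :: T) = count P z0.
  by rewrite -(seq.permP h) AE /T /= !count_cat /= !count_cat /=; ring.
have gm (i j : 'I_n) : q i j * q j i = q0^-1 -> cword [:: i; j] -> i \in A -> j \in A ->
   (forall v, perm_eq (i :: j :: v) z0 -> v != [::] -> cword v) ->
   perm_eq (m ++ i :: j :: T) z0 -> good (m ++ i :: j :: T).
  move=> qij cij iA jA hvij hp; apply/(good_rot_word rm hp).
  have hp' : perm_eq (i :: j :: T ++ m) z0.
    by rewrite -[i :: _]/((i :: j :: T) ++ m) perm_catC.
  by apply: good_pair => //; [exact: rA | exact: rA | apply: hvij].
rewrite AE -catA; apply/(good_rot_word ra); first by rewrite catA -AE.
have -> : ((s :: m ++ t :: b) ++ Y) ++ a = s :: m ++ t :: T by rewrite /T /= -!catA.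
case: st => -[sE tE]; subst s t.
  apply: (@good_sim _ (m ++ l :: l1 :: T)).
    have := sim_cat2 (sim_pass fm) (sim_refl (l1 :: T)).
    by rewrite cat_rcons.
  apply: gm => //; first by apply: cword_adj; left.
  by apply/seq.permP => P; rewrite -h1 /= !count_cat /=; ring.
apply: (@good_sim _ ((l1 :: l :: m) ++ T)).
  have := sim_cat2 (sim_refl [:: l1]) (sim_cat2 (sim_pass_left fm) (sim_refl T)).
  by rewrite cat_rcons.
apply: good_pair => //; [exact: rA | exact: rA | | |].
- by apply: cword_adj; right.
- by apply/seq.permP => P; rewrite -h1 /T /= !count_cat /= !count_cat; ring.
move=> hT; apply: hv => //; apply/seq.permP => P; rewrite -h1 /T /= !count_cat /= !count_cat; ring.
Qed.

Lemma wm_nseq_ge i (k : nat) : (N <= k)%N -> wm (nseq k i) = 0.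
Proof. by move=> Nk; rewrite -(subnKC Nk) nseqD wmx_cat X_pow mul0mx. Qed.

Lemma q0_pow_neq1 (k : nat) : (0 < k < N)%N -> q0 ^+ k != 1.
Proof.
move=> /andP[k0 kN]; rewrite -(prim_order_dvd prim); apply: contraL kN => /dvdn_leq.
by rewrite -leqNgt; apply.
Qed.

(** The bracket of x_i and x_i^(k+1) is (1 - q^(k+1)) x_i^(k+2), with a nonzero scalar when k + 1 <
    N; for larger k the power itself vanishes. *)
Lemma good_nseq i (k : nat) : z0 = nseq k.+1 i -> good (nseq k.+1 i).
Proof.
case: k => [|k] zE.
  rewrite zE wmx1; apply: lie_ext (lie_tmx (BLeaf i)) => j.
  by rewrite /wdeg /= addn0.
have [Nk|kN] := leqP N k.+1.
  by rewrite wm_nseq_ge ?(leqW Nk) //; apply: lspan0.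
have := @good_brk [:: i] (nseq k.+1 i); rewrite zE perm_refl => /(_ isT (cword1 i) (cword_nseq _ _)).
have -> : nseq k.+1 i ++ [:: i] = nseq k.+2 i by rewrite -(nseqD k.+1 1) addn1.
have cwE (m : nat) : cw (nseq m i) [:: i] = q0 ^+ m.
  elim: m => [|m IHm]; first exact: big_nil.
  by rewrite [nseq _ _]/= cw_consl IHm q_diag exprS.
rewrite cwE.
rewrite -[[:: i] ++ nseq k.+1 i]/(nseq k.+2 i) -{1}[wm _]scale1r -scalerBl.
by apply: lie_scale_inv; rewrite subr_eq0 eq_sym q0_pow_neq1 //.
Qed.

(* If some interior letter j occurs once, take the least one and split off the letters A below j: z0 reduces to A ++ Y with every letter of A rotatable. Either A is a power of the least letter l, and the two brackets of A and Y suffice, or rotations bring l and l+1 to the front. *)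
Lemma good_connected : cword z0 -> good z0.
Proof.
move=> cz; have /connP[[i0 i0z] convz] := cz.
have [l lz lmin] : exists2 l, l \in z0 & forall x, x \in z0 -> (l <= x)%N.
  by case: (arg_minnP (fun i : 'I_n => i : nat) i0z) => l lz h; exists l.
have [/all_pred1P zE|/allPn[x xz /= xl]] := boolP (all (pred1 l) z0).
  case E: (size z0) => [|k]; first by move: i0z; rewrite (size0nil E).
  have zE' : z0 = nseq k.+1 l by rewrite -E.
  by have := good_nseq zE'; rewrite -zE'.
have lx : (l < x)%N by rewrite ltn_neqAle lmin // andbT eq_sym.
have [l1 ll1 l1z] : exists2 l1 : 'I_n, l1 = l.+1 :> nat & l1 \in z0.
  have [e|lx'] := eqVneq (x : nat) l.+1; first by exists x.
  exists (Ordinal (leq_ltn_trans lx (ltn_ord x))) => //.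
  by apply: convz lz xz; rewrite /= ltnSn ltn_neqAle eq_sym lx'.
have neq : l1 != l by rewrite -val_eqE /= ll1 neq_ltn ltnSn orbT.
have other i : exists2 y, y \in z0 & y != i.
  by have [<-|li] := eqVneq l i; [exists x | exists l].
have rotP i := rotatableP cz (other i).
(* Removing the least letter l opens no gap; removing l1 as well could only open one at l1 itself,
   which the hypothesis excludes. *)
have pairv : (forall x, x \in z0 -> (x <= l1)%N) \/ (1 < count_mem l1 z0)%N ->
    forall v, perm_eq (l :: l1 :: v) z0 -> v != [::] -> cword v.
  move=> hl1 v hv vn; have hm := perm_mem hv; apply/connP; split.
    by case: v vn {hv hm} => // y v _; exists y; rewrite inE eqxx.
  move=> a b c abc av cv.
  have az : a \in z0 by rewrite -hm !inE av !orbT.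
  have cz' : c \in z0 by rewrite -hm !inE cv !orbT.
  have := convz _ _ _ abc az cz'; rewrite -hm !inE => /or3P[/eqP bl|/eqP bl1|//].
    by move: abc; rewrite bl ltnNge lmin.
  subst b; case: hl1 => [/(_ _ cz')|]; first by rewrite leqNgt; case/andP: abc => _ ->.
  by rewrite -(seq.permP hv) /= eqxx eq_sym (negbTE neq) add0n add1n ltnS -has_count has_pred1.
pose P j := [&& (l < j)%N, has (fun h : 'I_n => (j < h)%N) z0 & count_mem j z0 == 1%N].
have safe i : i \in z0 -> ~~ P i -> [\/ forall x, x \in z0 -> (i <= x)%N,
    forall x, x \in z0 -> (x <= i)%N | (1 < count_mem i z0)%N].
  move=> iz; rewrite /P; case: ltnP => [li|il _]; last first.
    by apply: Or31 => y /lmin; apply: leq_trans.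
  case: hasP => [_|hn _] /=; last first.
    by apply: Or32 => y yz; rewrite leqNgt; apply/negP => iy; apply: hn; exists y.
  move=> h; apply: Or33; rewrite ltn_neqAle eq_sym h -has_count has_pred1.
  exact: iz.
have [/existsP[j Pj]|/existsPn noP] := boolP [exists j, P j]; last first.
  have := @good_pair_mem l l1 z0 [::] ll1; rewrite cats0; apply=> //.
  - by move=> i iz; apply/rotP/safe.
  - apply: pairv; case: (safe _ l1z (noP l1)) => [/(_ _ lz)|h|h]; [by rewrite ll1 ltnn|by left|by right].
case: (arg_minnP (fun i : 'I_n => i : nat) Pj) => {j Pj} j Pj jmin.
have /and3P[lj _ /eqP cj] := Pj.
have jz : j \in z0 by rewrite -has_pred1 has_count cj.
have notP i : (i < j)%N -> ~~ P i by move=> ij; apply: contraL ij => /jmin; rewrite leqNgt.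
pose z1 := take (index j z0) z0; pose z2 := drop (index j z0).+1 z0.
have zE : z0 = z1 ++ j :: z2 by rewrite /z1 /z2 -drop_index // cat_take_drop.
have [jz1 jz2] : j \notin z1 /\ j \notin z2.
  move: cj; rewrite zE count_cat /= eqxx -!has_pred1 !has_count -!leqNgt.
  by move: (count _ z1) (count _ z2) => c1 c2; clear; lia.
pose lt := fun i : 'I_n => (i < j)%N.
pose f := filter lt; pose g := filter (predC lt).
have farP x' y : y != j -> lt x' -> ~~ lt y -> far x' y.
  by rewrite /lt /far -val_eqE /=; clear; lia.
have sim1 : sim z1 (f z1 ++ g z1).
  by apply: sim_filter => a b _ bz; apply: farP; apply: contraNneq jz1 => <-.
have sim2 : sim z2 (g z2 ++ f z2).
  rewrite /f (@eq_filter _ lt (predC (predC lt))) => [|i]; last by rewrite /= negbK.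
  apply: sim_filter => a b az _ la /negbNE lb; rewrite far_sym; apply: farP => //.
  by apply: contraNneq jz2 => <-.
(* Letters below j move to the outer ends of the word, since j blocks their way inwards: z0 becomes
   f z1, g z1, j, g z2, f z2. Rotating f z2 to the front puts all of them before j. *)
pose A := f z2 ++ f z1; pose Y := g z1 ++ j :: g z2.
have hp : perm_eq (A ++ Y) z0.
  apply/seq.permP => p; rewrite zE.
  have h1 := seq.permP (permEl (perm_filterC lt z1)) p.
  have h2 := seq.permP (permEl (perm_filterC lt z2)) p.
  move: h1 h2; rewrite /A /Y /f /g !count_cat /=; clear; lia.
have memA i : (i \in A) = (i \in z0) && lt i.
  rewrite zE /A !mem_cat !mem_filter inE; case: (i =P j) => [->|_] /=.
    by rewrite /lt ltnn !andbF.
  by rewrite -andb_orr andbC orbC.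
have memY i : (i \in Y) = (i \in z0) && ~~ lt i.
  rewrite zE /Y !mem_cat !inE !mem_filter; case: (i =P j) => [->|_] /=.
    by rewrite /lt ltnn !orbT.
  by rewrite -andb_orr andbC.
have rA : {in A, forall i, rotatable i}.
  by move=> i; rewrite memA => /andP[iz /notP ij]; apply/rotP/safe.
suff gAY : good (A ++ Y).
  have gz : good ((f z1 ++ Y) ++ f z2).
    apply/(good_rot_word (u := f z2)); rewrite ?[f z2 ++ _]catA //.
    by move=> i iz2; apply: rA; rewrite mem_cat iz2.
  apply: good_sim gz; have := sim_cat2 sim1 (sim_cat2 (sim_refl [:: j]) sim2).
  by rewrite -[[:: j] ++ z2]/(j :: z2) -zE /Y -!catA.
have lA : l \in A by rewrite memA lz.
have [jl1|jl1] := eqVneq j l1; last first.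
  have l1j : (l1 < j)%N by rewrite ltn_neqAle eq_sym jl1 ll1.
  apply: (good_pair_mem ll1) => //.
  - by rewrite memA l1z.
  - by move=> i; rewrite memA => /andP[/lmin].
  apply: pairv; case: (safe _ l1z (notP _ l1j)) => [/(_ _ lz)|h|h]; [by rewrite ll1 ltnn|by left|by right].
have /all_pred1P AE : all (pred1 l) A.
  apply/allP => i; rewrite memA => /andP[/lmin li]; rewrite /lt jl1 ll1 => il.
  by apply/eqP/val_inj/eqP; rewrite eqn_leq li andbT.
have A0 : (0 < size A)%N by move: lA; case: (A).
have [NA|AN] := leqP N (size A).
  by rewrite wmx_cat AE wm_nseq_ge // mul0mx; apply: lspan0.
have fg z : all (far l) (filter (predC lt) z) \/ j \in z.
  have [|jz'] := boolP (j \in z); [by right | left].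
  apply/allP => i; rewrite mem_filter => /andP[/= il iz].
  by apply: farP => //; apply: contraNneq jz' => <-.
have f1 : all (far l) (g z1) by case: (fg z1) => // h; rewrite h in jz1.
have f2 : all (far l) (g z2) by case: (fg z2) => // h; rewrite h in jz2.
(* Here A is a power of l, and the single j = l + 1 is the only letter of Y not far from l. The
   symmetrized character is thus q^(-|A|), which is not 1 because 0 < |A| < N. *)
apply: good_two_brackets => //.
- by rewrite AE; case: (size A) A0 => // m _; apply: cword_nseq.
- apply/connP; split; first by exists j; rewrite memY jz /lt ltnn.
  move=> a b c abc; rewrite !memY /lt -!leqNgt => /andP[az ja] /andP[cz' jc].
  by rewrite (convz _ _ _ abc az cz') /=; clear -abc ja; lia.
rewrite AE cw_nseq_sym /Y cw_catr cw_catl cw_consr cw_consl.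
have -> : cw [:: l] (g z1) * (q l j * cw [:: l] (g z2)) *
   (cw (g z1) [:: l] * (q j l * cw (g z2) [:: l])) =
   (cw [:: l] (g z1) * cw (g z1) [:: l]) * (cw [:: l] (g z2) * cw (g z2) [:: l])
   * (q l j * q j l) by ring.
rewrite !cw1_far // !mul1r q_adj ?jl1 // exprVn invr_eq1; apply: q0_pow_neq1.
by rewrite A0.
Qed.

End InductionStep.

Lemma connected_word_lie w : cword w -> lie (wdeg w) (wm w).
Proof.
have [m] := ubnP (size w); elim: m w => // m IH w wm cw.
by apply: good_connected => // u uw; apply: IH; apply: leq_trans uw _.
Qed.

Lemma X_tmx i t : (forall j, (0 < bdeg t j)%N -> far i j) ->
  X i *m tmx t = chi (bdeg (BLeaf i)) (bdeg t) *: (tmx t *m X i).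
Proof.
elim: t => [j|a IHa b IHb] h /=.
  by rewrite -/(bdeg (BLeaf i)) chi_leaf X_comm //; apply: h; rewrite /= eqxx.
have {}IHa := IHa (fun j hj => h j (ltn_addr _ hj)).
have {}IHb := IHb (fun j hj => h j (ltn_addl _ hj)).
rewrite chiDr mulmxBr mulmxBl scalerBr -scalemxAr -scalemxAl.
rewrite !mulmxA IHa IHb -!scalemxAl -!mulmxA IHa IHb -!scalemxAr !scalerA.
by congr (_ *: _ - _ *: _); ring.
Qed.

Lemma tmx_comm s t : (forall i j, (0 < bdeg s i)%N -> (0 < bdeg t j)%N -> far i j) ->
  tmx s *m tmx t = chi (bdeg s) (bdeg t) *: (tmx t *m tmx s).
Proof.
elim: s => [i|a IHa b IHb] h /=.
  by rewrite -X_tmx // => j; apply: h; rewrite /= eqxx.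
have {}IHa := IHa (fun i j hi => h i j (ltn_addr _ hi)).
have {}IHb := IHb (fun i j hi => h i j (ltn_addl _ hi)).
rewrite chiDl mulmxBr mulmxBl scalerBr -scalemxAr -scalemxAl -!mulmxA IHa IHb.
rewrite -!scalemxAr !mulmxA IHa IHb -!scalemxAl !scalerA.
by congr (_ *: _ - _ *: _); ring.
Qed.

Definition ctree t := conn (fun i => (0 < bdeg t i)%N).

(** If both subtrees are connected but their union is not, their supports are mutually far. The two
    values then commute up to exactly the scalar in the bracket, which vanishes. *)
Lemma tmx_disconnected t : ~~ ctree t -> tmx t = 0.
Proof.
elim: t => [i|a IHa b IHb] h /=.
  case/negP: h; rewrite /ctree (@eq_conn _ _ (fun j => j \in [:: i])); first exact: cword1.
  move=> j.
  by rewrite /= inE eq_sym; case: eqP.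
have [ca|/IHa ->] := boolP (ctree a); last by rewrite mulmx0 mul0mx scaler0 subr0.
have [cb|/IHb ->] := boolP (ctree b); last by rewrite mulmx0 mul0mx scaler0 subr0.
rewrite tmx_comm ?subrr // => i j bi aj; apply: contraNT h => nf.
have /connP[_ va] := ca; have /connP[_ vb] := cb.
apply/connP; split; first by exists i; rewrite /= addn_gt0 bi orbT.
move=> x y z xyz /=; rewrite !addn_gt0 => /orP[ax|bx] /orP[az|bz]; apply/orP.
- by left; apply: va ax az.
- have [yj|jy|/val_inj->] := ltngtP y j; last by left.
    by left; apply: (va x y j) => //; clear -xyz yj; lia.
  have [yi|iy|/val_inj->] := ltngtP y i; last by right.
    by move: nf; rewrite /far; clear -jy yi; lia.
  by right; apply: (vb i y z) => //; clear -xyz iy; lia.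
- have [yi|iy|/val_inj->] := ltngtP y i; last by right.
    by right; apply: (vb x y i) => //; clear -xyz yi; lia.
  have [yj|jy|/val_inj->] := ltngtP y j; last by left.
    by move: nf; rewrite /far; clear -iy yj; lia.
  by left; apply: (va j y z) => //; clear -xyz jy; lia.
by right; apply: vb bx bz.
Qed.


End BraidedLie.

(** * Counting exponents with connected support *)

Section FirstGap.
Implicit Types (S : pred nat) (i j k l m : nat).

Definition nonempty_below S m := [exists i : 'I_m, S i].
Definition interval_below S m := nonempty_below S m &&
  [forall i : 'I_m, forall j : 'I_m, forall l : 'I_m, (i < j < l)%N ==> S i ==> S l ==> S j].
(** k is the last index missing between the first component of S and the next one, which starts at k
    + 1. *)
Definition first_gap S k := [&& interval_below S k, ~~ S k & S k.+1].

Lemma nonempty_belowP S m : reflect (exists2 i, (i < m)%N & S i) (nonempty_below S m).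
Proof.
apply: (iffP existsP) => [[i Si]|[i im Si]]; first by exists i.
by exists (Ordinal im).
Qed.

Lemma interval_belowP S m : reflect ((exists2 i, (i < m)%N & S i) /\
  forall i j l, (i < j)%N -> (j < l)%N -> (l < m)%N -> S i -> S l -> S j) (interval_below S m).
Proof.
apply: (iffP andP) => [[/nonempty_belowP h1 /forallP h2]|[/nonempty_belowP h1 h]]; split=> //.
  move=> i j l ij jl lm Si Sl.
  have jm := ltn_trans jl lm; have im := ltn_trans ij jm.
  have /forallP/(_ (Ordinal jm))/forallP/(_ (Ordinal lm)) := h2 (Ordinal im).
  by rewrite /= ij jl Si Sl.
do 3!apply/forallP => ?; apply/implyP => /andP[? ?]; do 2!apply/implyP => ?.
by apply: h; eauto.
Qed.

Lemma eq_interval_below S S' m : (forall i, (i < m)%N -> S i = S' i) ->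
  interval_below S m = interval_below S' m.
Proof.
move=> h; rewrite /interval_below /nonempty_below; congr (_ && _).
  by apply: eq_existsb => i; apply: h.
by do 3!apply: eq_forallb => ?; rewrite !h.
Qed.

Lemma interval_belowS S m : ~~ S m -> interval_below S m.+1 = interval_below S m.
Proof.
move=> Sm; apply/interval_belowP/interval_belowP => -[[i im Si] h].
  split; last by move=> a b c ab bc cm; apply: (h a b c) => //; apply: leqW.
  exists i => //; move: im; rewrite ltnS leq_eqVlt => /orP[/eqP e|//].
  by rewrite -e Si in Sm.
split; first by exists i => //; apply: leqW.
move=> a b c ab bc; rewrite ltnS leq_eqVlt => /orP[/eqP->|cm]; first by rewrite (negbTE Sm).
exact: (h a b c).
Qed.

(** Truth values are added as numbers, so the equation gives existence and uniqueness of the first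
    gap of a nonempty set that is not an interval. *)
Lemma interval_or_gap S m :
  (interval_below S m + \sum_(k < m.-1) first_gap S k)%N = nonempty_below S m.
Proof.
elim: m => [|m IH].
  rewrite big_ord0 addn0 /interval_below /nonempty_below.
  by case: existsP => // -[[]].
have gapE : (\sum_(k < m) first_gap S k =
    \sum_(k < m.-1) first_gap S k + (if m is m'.+1 then first_gap S m' : nat else 0))%N.
  by case: (m) => [|m']; rewrite ?big_ord0 ?big_ord_recr.
rewrite [m.+1.-1]/= gapE addnA.
have [Sm|Sm] := boolP (S m); last first.
  rewrite interval_belowS // IH.
  have -> : nonempty_below S m.+1 = nonempty_below S m.
    apply/nonempty_belowP/nonempty_belowP => -[i im Si]; exists i => //; last exact: leqW.
    by move: im; rewrite ltnS leq_eqVlt => /orP[/eqP e|//]; rewrite -e Si in Sm.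
  by case: (m) Sm => [|m'] Sm; rewrite ?addn0 // /first_gap (negbTE Sm) !andbF addn0.
have -> : nonempty_below S m.+1 by apply/nonempty_belowP; exists m.
case: m {gapE} IH Sm => [|m] IH Sm.
  rewrite big_ord0 !addn0 (_ : interval_below S 1) //.
  apply/interval_belowP; split; first by exists 0%N.
  by move=> i j [|l] //.
have [Spm|Spm] := boolP (S m).
  have -> : interval_below S m.+2 = interval_below S m.+1.
    apply/interval_belowP/interval_belowP => -[_ h].
      split; first by exists m.
      by move=> a b c ab bc cm; apply: (h a b c) => //; apply: leqW.
    split; first by exists m.+1.
    move=> a b c ab bc; rewrite ltnS leq_eqVlt => /orP[/eqP cE|cm]; last exact: (h a b c).
    move=> Sa _; have [bm|mb|->//] := ltngtP b m; first exact: (h a b m).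
    by move: bc; rewrite cE ltnNge mb.
  have -> : first_gap S m = false by rewrite /first_gap Spm /= andbF.
  rewrite addn0 IH; have -> : nonempty_below S m.+1; last by [].
  by apply/nonempty_belowP; exists m.
have -> : first_gap S m = interval_below S m.+1.
  by rewrite /first_gap Spm Sm andbT andbT interval_belowS.
have [/nonempty_belowP[i im Si]|ne] := boolP (nonempty_below S m.+1); last first.
  have -> : interval_below S m.+1 = false by rewrite /interval_below (negbTE ne).
  have -> : interval_below S m.+2.
    apply/interval_belowP; split; first by exists m.+1.
    move=> a b c ab bc cm Sa _; case/negP: ne; apply/nonempty_belowP; exists a => //.
    by apply: leq_trans (leq_trans bc _) => //; exact: ltnW.
  move: IH; rewrite (negbTE ne) => /eqP; rewrite addn_eq0 => /andP[_ /eqP ->].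
  by [].
have -> : interval_below S m.+2 = false.
  apply/interval_belowP => -[_ h]; have lim : (i < m)%N.
    by move: im; rewrite ltnS leq_eqVlt => /orP[/eqP e|//]; rewrite -e Si in Spm.
  by move: Spm; rewrite (h i m m.+1).
rewrite add0n addnC IH; have -> : nonempty_below S m.+1; last by [].
by apply/nonempty_belowP; exists i.
Qed.

End FirstGap.

(** * The recursion for exponents with connected support *)

Section Counting.
Variables n p : nat.
Implicit Types (e : expo n p) (x y k l m : nat) (r : pos_root n).
Local Notation N := p.+2.

Definition in_supp e (l : nat) : bool :=
  [exists r : pos_root n, (e r != 0) && ((val r).1 <= l <= (val r).2)%N].

Lemma in_suppP e l : reflect (exists2 r, e r != 0 & ((val r).1 <= l <= (val r).2)%N) (in_supp e l).
Proof.
by apply: (iffP existsP) => [[r /andP[h1 h2]]|[r h1 h2]]; exists r => //; rewrite h1.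
Qed.

Lemma in_supp_deg e (l : 'I_n) : in_supp e l = (0 < deg e l)%N.
Proof.
rewrite lt0n sum_nat_eq0; apply/in_suppP/idP => [[r er rl]|/forallPn[r]].
  by apply/forallPn; exists r; rewrite rl implyTb.
by rewrite negb_imply => /andP[rl er]; exists r.
Qed.

Definition within x y : {set expo n p} :=
  [set e : expo n p | [forall r : pos_root n, (e r != 0) ==> ((x <= (val r).1) && ((val r).2 < y))%N]].

Lemma withinP x y e : reflect (forall r, e r != 0 -> (x <= (val r).1)%N /\ ((val r).2 < y)%N)
  (e \in within x y).
Proof.
rewrite inE; apply: (iffP forallP) => h r.
  by move=> er; have := h r; rewrite er => /andP.
by apply/implyP => /h[-> ->].
Qed.

Lemma card_roots x y : (y <= n)%N ->
  #|[pred r : pos_root n | (x <= (val r).1)%N && ((val r).2 < y)%N]| = 'C((y - x).+1, 2).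
Proof.
move=> yn; pose D := [pred ab : 'I_n * 'I_n | [&& ab.1 <= ab.2, x <= ab.1 & ab.2 < y]%N].
have -> : #|[pred r : pos_root n | (x <= (val r).1)%N && ((val r).2 < y)%N]| = #|D|.
  rewrite -(card_image val_inj); apply: eq_card => ab; apply/imageP/idP => [[r]|].
    by rewrite !inE => h ->; rewrite (valP r).
  by rewrite !inE => /and3P[h1 h2 h3]; exists (exist _ ab h1); rewrite ?inE ?h2.
rewrite -sum1_card -(pair_big_dep predT (fun a b => D (a, b)) (fun _ _ => 1%N)) /=.
rewrite (exchange_big_dep predT) //=.
rewrite (eq_bigr (fun b : 'I_n => if (b < y)%N then b.+1 - x else 0)%N) => [|b _]; last first.
  case: ltnP => hb; last by rewrite big1 // => a /=; rewrite ?andbF.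
  rewrite -[RHS]muln1 -sum_nat_const_nat big_geq_mkord.
  rewrite (big_ord_widen_cond n (fun a => (x <= a)%N) (fun _ => 1%N) (ltn_ord b)).
  by apply: eq_bigl => a; rewrite /= andbT andbC ltnS.
rewrite -big_mkcond -(big_ord_widen n (fun b => b.+1 - x)%N yn).
elim: y {yn D} => [|y IH]; first by rewrite big_ord0.
rewrite big_ord_recr /= IH; case: (leqP x y) => h; first by rewrite subSn // [in RHS]binS bin1.
have -> : (y.+1 - x = 0)%N by apply/eqP; rewrite subn_eq0.
by have -> : (y - x = 0)%N by apply/eqP; rewrite subn_eq0 ltnW.
Qed.

Lemma card_within x y : (y <= n)%N -> #|within x y| = (N ^ 'C((y - x).+1, 2))%N.
Proof.
move=> yn; rewrite -(card_roots x yn) -[X in (X ^ _)%N](card_ord N) -(card_pffun_on 0).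
apply: eq_card => e; apply/withinP/pffun_onP => [h|[h _] r er].
  by split=> // ; apply/subsetP => r /h [h1 h2]; rewrite inE h1.
by have /andP := subsetP h r er.
Qed.

Definition conn_within m := [set e in within 0 m | interval_below (in_supp e) m].
Definition right_part k m := [set e in within k.+1 m | in_supp e k.+1].

(** Among the exponents on [k+1, m), those whose support misses k + 1 are the exponents on [k+2, m);
    this is the difference of powers in the formula. *)
Lemma card_right_part k m : (k.+1 < m)%N -> (m <= n)%N ->
  (#|right_part k m| + N ^ 'C(m - k - 1, 2) = N ^ 'C(m - k, 2))%N.
Proof.
move=> km mn.
have -> : 'C(m - k - 1, 2) = 'C((m - k.+2).+1, 2) by congr 'C(_, _); lia.
have -> : 'C(m - k, 2) = 'C((m - k.+1).+1, 2) by congr 'C(_, _); lia.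
rewrite -!card_within // -(cardsID [set e | in_supp e k.+1] (within k.+1 m)).
congr (_ + _)%N; apply: eq_card => e; rewrite !inE //.
apply/forallP/andP => [h|[hs /forallP h] r].
  split; last first.
    by apply/forallP => r; apply/implyP => er; have := h r; rewrite er => /andP[/ltnW -> ->].
  by apply/in_suppP => -[r er]; have := h r; rewrite er => /andP[h1 _]; rewrite [(_ <= k.+1)%N]leqNgt h1.
apply/implyP => er; have := h r; rewrite er => /andP[h1 h2]; rewrite h2 andbT ltn_neqAle h1 andbT.
apply: contraNneq hs => h3; apply/in_suppP; exists r => //.
by rewrite h3 leqnn (valP r).
Qed.

Definition cut x y e : expo n p :=
  [ffun r : pos_root n => if (x <= (val r).1)%N && ((val r).2 < y)%N then e r else 0].

Lemma cut_within x y e : cut x y e \in within x y.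
Proof. by apply/withinP => r; rewrite ffunE; case: andP => //; rewrite eqxx. Qed.

(** No root in use contains k, so each lies wholly to one side of k. The left part has interval
    support; the right part only has to reach k + 1 and is otherwise free. *)
Lemma card_first_gap k m : (k.+1 < m)%N ->
  #|[set e in within 0 m | first_gap (in_supp e) k]| = (#|conn_within k| * #|right_part k m|)%N.
Proof.
move=> km; rewrite -cardsX.
have cutl e1 e2 : e1 \in within 0 k -> e2 \in within k.+1 m -> cut 0 k (e1 + e2) = e1.
  move=> /withinP h1 /withinP h2; apply/ffunP => r; rewrite !ffunE.
  have [e1r|/h1[_ rk]] := eqVneq (e1 r) 0.
    have [e2r|/h2[rk _]] := eqVneq (e2 r) 0; first by rewrite e1r e2r addr0 if_same.
    rewrite e1r ltnNge (_ : (k <= _)%N) //.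
    by apply: leq_trans (valP r); exact: ltnW.
  rewrite rk /=; have [->|/h2[rk' _]] := eqVneq (e2 r) 0; first by rewrite addr0.
  by have := leq_trans rk' (leq_trans (valP r) (ltnW rk)); rewrite ltnn.
have inj : {in setX (conn_within k) (right_part k m) &,
    injective (fun u : expo n p * expo n p => u.1 + u.2)}.
  have mem a b : (a, b) \in setX (conn_within k) (right_part k m) ->
      a \in within 0 k /\ b \in within k.+1 m.
    by rewrite in_setX => /andP[]; rewrite /= in_set => /andP[-> _]; rewrite in_set => /andP[].
  move=> [a b] [a' b'] /mem[a1 b1] /mem[a1' b1'] h.
  have := congr1 (cut 0 k) h; rewrite /= !cutl // => ha.
  by move: h; rewrite /= ha => /addrI ->.
rewrite -(card_in_imset inj); apply: eq_card => e.
apply/idP/imsetP => [|[[a b]]].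
  rewrite inE => /andP[/withinP ew /and3P[ck nk sk]].
  have eE : e = cut 0 k e + cut k.+1 m e.
    apply/ffunP => r; rewrite !ffunE /=.
    have [->|er] := eqVneq (e r) 0; first by rewrite !if_same addr0.
    have [_ rm] := ew _ er; rewrite rm andbT.
    have : ~~ ((val r).1 <= k <= (val r).2)%N by apply: contraNN nk => h; apply/in_suppP; exists r.
    rewrite negb_and -!ltnNge => /orP[h|h].
      by rewrite h ltnNge (leq_trans (ltnW h) (valP r)) add0r.
    by rewrite h ltnNge (leq_trans (valP r) (ltnW h)) addr0.
  exists (cut 0 k e, cut k.+1 m e) => //; rewrite inE /=; apply/andP; split.
    rewrite inE cut_within; rewrite -(@eq_interval_below (in_supp e)) // => i ik.
    apply/in_suppP/in_suppP => -[r er ri]; exists r => //.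
      rewrite ffunE /=; case: ltnP => // kr; case/negP: nk; apply/in_suppP; exists r => //.
      by rewrite kr andbT (leq_trans _ (ltnW ik)) //; case/andP: ri.
    by move: er; rewrite ffunE; case: ifP; rewrite ?eqxx.
  rewrite inE cut_within /=; case/in_suppP: sk => r er rk; apply/in_suppP; exists r => //.
  have [_ rm] := ew _ er; rewrite ffunE rm andbT ltnNge.
  case: leqP => // rk'; case/negP: nk; apply/in_suppP; exists r => //.
  by rewrite rk' ltnW //; case/andP: rk.
rewrite !inE /= => /andP[/andP[/forallP a1 ck] /andP[/forallP b1 sk]] ->.
have aw : a \in within 0 k by rewrite inE; apply/forallP.
have bw : b \in within k.+1 m by rewrite inE; apply/forallP.
have /withinP ha := aw; have /withinP hb := bw.
have ab0 r : (a r == 0) || (b r == 0).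
  apply/orP; have [|/ha[_ rk]] := eqVneq (a r) 0; first by left.
  have [|/hb[rk' _]] := eqVneq (b r) 0; first by right.
  by have := leq_trans rk' (leq_trans (valP r) (ltnW rk)); rewrite ltnn.
have abn r : ((a + b) r != 0) = (a r != 0) || (b r != 0).
  by rewrite ffunE; case/orP: (ab0 r) => /eqP->; rewrite ?add0r ?addr0 eqxx ?orbF.
apply/andP; split.
  apply/forallP => r; apply/implyP; rewrite abn => /orP[/ha[_ h]|/hb[_ ->//]].
  by rewrite (ltn_trans h) //= ltnW.
have supk r l : b r != 0 -> (l <= k)%N -> ~~ ((val r).1 <= l <= (val r).2)%N.
  by move=> /hb[h _] lk; rewrite negb_and -ltnNge (leq_ltn_trans lk h).
apply/and3P; split.
- rewrite (@eq_interval_below _ (in_supp a)) // => i ik; apply/in_suppP/in_suppP => -[r er ri]; exists r => //.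
    move: er; rewrite abn => /orP[//|br].
    by have := supk _ _ br (ltnW ik); rewrite ri.
  by rewrite abn er.
- apply/in_suppP => -[r]; rewrite abn => /orP[/ha[_ h]|br]; first by rewrite [(k <= _)%N]leqNgt h andbF.
  by apply/negP/supk.
by case/in_suppP: sk => r er rk; apply/in_suppP; exists r => //; rewrite abn er orbT.
Qed.

Lemma nonempty_in_supp e m : e \in within 0 m -> nonempty_below (in_supp e) m = (e != 0).
Proof.
move=> /withinP h; apply/nonempty_belowP/idP => [[i _ /in_suppP[r er _]]|en0].
  by apply: contraNneq er => ->; rewrite ffunE.
have [r er] : exists r, e r != 0.
  apply/existsP; apply: contraR en0 => /existsPn hn; apply/eqP/ffunP => r.
  by rewrite ffunE; have := hn r; rewrite negbK => /eqP.
have [_ rm] := h _ er; exists (val r).2 => //; apply/in_suppP; exists r => //.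
by rewrite leqnn andbT (valP r).
Qed.

Lemma conn_within_rec m : (m <= n)%N ->
  (N ^ 'C(m.+1, 2) = 1 + (#|conn_within m| +
     \sum_(k < m.-1) #|conn_within k| * #|right_part k m|))%N.
Proof.
move=> mn; have := card_within 0 mn; rewrite subn0 => <-.
have z0 : (0 : expo n p) \in within 0 m by apply/withinP => r; rewrite ffunE eqxx.
rewrite (cardsD1 (0 : expo n p)) z0; congr (_ + _)%N.
have -> : #|within 0 m :\ (0 : expo n p)| = (\sum_(e in within 0 m) nonempty_below (in_supp e) m)%N.
  rewrite -sum1_card big_mkcond [RHS]big_mkcond; apply: eq_bigr => e _.
  by rewrite in_setD1; case: (boolP (e \in _)) => [/nonempty_in_supp->|_]; rewrite ?andbF ?andbT //; case: eqP.
under eq_bigr => e _ do rewrite -interval_or_gap.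
rewrite big_split /=; congr (_ + _)%N.
  rewrite -sum1_card big_mkcond [RHS]big_mkcond; apply: eq_bigr => e _.
  by rewrite [in RHS]inE; case: (e \in _); case: interval_below.
rewrite exchange_big /=; apply: eq_bigr => k _; rewrite -card_first_gap; last by have := ltn_ord k; lia.
rewrite -sum1_card big_mkcond [RHS]big_mkcond; apply: eq_bigr => e _.
by rewrite [in RHS]inE; case: (e \in _); case: first_gap.
Qed.

(** Solving the recursion for the connected count and unfolding it gives the alternating signs. Each
    unfolding lowers m by at least 2, so J terms suffice for m at most 2J. *)
Lemma card_conn_within J m : (m <= n)%N -> (m <= J.*2)%N ->
  (#|conn_within m|%:Z = \sum_(j < J) (-1) ^+ j * Schain N j m)%R.
Proof.
elim: J m => [|J IH] m mn mJ.
  rewrite big_ord0; move: mJ; rewrite leqn0 => /eqP->.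
  rewrite (_ : #|_| = 0%N) //; apply: eq_card0 => e; rewrite inE.
  by apply/andP => -[_ /interval_belowP[[i]]].
have conn0 : #|conn_within 0| = 0%N.
  by apply: eq_card0 => e; rewrite inE; apply/andP => -[_ /interval_belowP[[i]]].
have expE a b : (a%:Z ^+ b = (a ^ b)%N%:Z)%R by rewrite -!natz natrX.
have rightE k : (1 <= k < m.-1)%N ->
    (N%:Z ^+ 'C(m - k, 2) - N%:Z ^+ 'C(m - k - 1, 2) = #|right_part k m|%:Z)%R.
  move=> /andP[_ km]; rewrite !expE -(@card_right_part k m) //; last by lia.
  by rewrite PoszD addrK.
have recm : (N%:Z ^+ 'C(m.+1, 2) - 1 = #|conn_within m|%:Z
    + \sum_(1 <= k < m.-1) #|right_part k m|%:Z * #|conn_within k|%:Z)%R.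
  rewrite expE conn_within_rec // !PoszD addrAC subrr add0r; congr (_ + _).
  rewrite -(big_mkord xpredT (fun k => #|conn_within k| * #|right_part k m|)%N).
  have [m0|m0] := posnP m.-1; first by rewrite m0 !big_geq.
  rewrite big_ltn // conn0 mul0n add0n -natz natr_sum.
  by apply: eq_bigr => k _; rewrite natrM !natz mulrC.
rewrite big_ord_recl expr0 mul1r [Schain N 0 m]/= recm.
rewrite -[LHS]addr0 -addrA; congr (_ + _); apply/esym/eqP.
under [X in _ + X]eq_bigr => j _ do rewrite lift0 exprS mulN1r mulNr /= mulr_sumr.
rewrite sumrN exchange_big /= subr_eq0; apply/eqP/eq_big_nat => k km.
rewrite IH; try by case/andP: km; lia.
rewrite mulr_sumr; apply: eq_bigr => j _.
by rewrite rightE // mulrCA.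
Qed.

End Counting.

(** * Dimensions *)

Section Trees.
Variable n : nat.
Implicit Types (t : btree 'I_n).

Lemma bsize_gt0 t : (0 < bsize t)%N.
Proof. by elim: t => //= a ha b hb; rewrite addn_gt0 ha. Qed.

Lemma sum_bdeg t : (\sum_i bdeg t i)%N = bsize t.
Proof.
elim: t => [i|a IHa b IHb] /=; last by rewrite big_split /= IHa IHb.
by rewrite (bigD1 i) //= eqxx big1 // => j ji; rewrite eq_sym (negbTE ji).
Qed.

(** Membership is stated after applying g, because trees carry no decidable equality here whereas
    their images do. *)
Lemma mem_map_btrees_fuel f k (V : eqType) (g : btree 'I_n -> V) v : (k <= f)%N ->
  v \in map g (btrees_fuel n f k) <-> exists2 t, bsize t = k & v = g t.
Proof.
elim: f k V g v => [|f IH] k V g v kf.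
  by split=> // -[t tk _]; move: (bsize_gt0 t) kf; rewrite tk leqn0 lt0n => /negbTE ->.
rewrite /=; case: eqP => [->|k1].
  rewrite -map_comp; split=> [/mapP[i _ ->]|]; first by exists (BLeaf i).
  case=> -[i _ ->|a b /= ab _]; first by apply/mapP; exists i; rewrite ?mem_enum.
  by move: (bsize_gt0 a) (bsize_gt0 b) ab; clear; lia.
rewrite map_flatten -map_comp; split=> [/flattenP[s /mapP[a]]|].
  rewrite mem_iota => /andP[a0 ak] -> /=; rewrite map_allpairs => /flattenP[s'].
  case/IH => [|t1 t1a ->]; first by lia.
  case/IH => [|t2 t2a ->]; first by lia.
  by exists (BNode t1 t2) => //=; rewrite t1a t2a; lia.
case=> -[i /= /esym//|a b /= ab ->]; have a0 := bsize_gt0 a; have b0 := bsize_gt0 b.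
apply/flattenP; eexists; first by apply/mapP; exists (bsize a); rewrite ?mem_iota; [lia|].
rewrite /= map_allpairs; apply/flattenP; eexists; first by apply/IH; [lia | exists a].
by apply/IH; [lia | exists b; [lia|]].
Qed.

Lemma mem_map_btrees k (V : eqType) (g : btree 'I_n -> V) v :
  v \in map g (btrees n k) <-> exists2 t, bsize t = k & v = g t.
Proof. exact: mem_map_btrees_fuel. Qed.

End Trees.

(** * Evaluation of bracket tensors at matrices *)

Section TensorToMatrix.
Variables (F : fieldType) (n d : nat) (q : 'I_n -> 'I_n -> F) (X : 'I_n -> 'M[F]_d).

Definition tensor_mx k (f : seq 'I_n -> F) : 'M[F]_d :=
  \sum_(w : k.-tuple 'I_n) f w *: wmx X w.

Lemma tensor_mx_tmul a b f g :
  tensor_mx (a + b) (tmul a f g) = tensor_mx a f *m tensor_mx b g.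
Proof.
rewrite /tensor_mx mulmx_suml.
under [RHS]eq_bigr => u _ do rewrite mulmx_sumr.
rewrite pair_big /=.
rewrite (reindex (fun x : a.-tuple 'I_n * b.-tuple 'I_n => cat_tuple x.1 x.2)) /=.
  apply: eq_bigr => -[u v] _ /=; rewrite /tmul take_size_cat ?size_tuple //.
  by rewrite drop_size_cat ?size_tuple // wmx_cat -scalemxAl -scalemxAr scalerA.
apply: onW_bij; apply: inj_card_bij => [[u v] [u' v'] /= /(congr1 val) /= /eqP|].
  by rewrite eqseq_cat ?size_tuple // => /andP[/eqP h1 /eqP h2]; congr pair; apply: val_inj.
by rewrite card_prod !card_tuple expnD.
Qed.

Lemma tensor_mx_bvec t : tensor_mx (bsize t) (bvec q t) = tmx q X t.
Proof.
elim: t => [i|a IHa b IHb] /=.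
  rewrite /tensor_mx (bigD1 [tuple i]) //= eqxx scale1r mulmx1 big1 ?addr0 // => w wi.
  by rewrite (_ : _ == _ = false) ?scale0r //; apply: contraNF wi => /eqP h; apply/eqP/val_inj.
rewrite -IHa -IHb -!tensor_mx_tmul [(bsize b + bsize a)%N]addnC /tensor_mx scaler_sumr -sumrB.
by apply: eq_bigr => w _; rewrite scalerBl scalerA.
Qed.

Lemma tmx_word_span t :
  lspan (fun M => exists w, wdeg w =1 bdeg t /\ M = wmx X w) (tmx q X t).
Proof.
pose G t M := exists w, wdeg w =1 bdeg t /\ M = wmx X w.
have mulG a b A B : lspan (G a) A -> lspan (G b) B ->
    lspan (fun M => exists w, wdeg w =1 (fun i => bdeg a i + bdeg b i)%N /\ M = wmx X w) (A *m B).
  move=> hA hB; apply: (@lspan_map _ _ _ (G a) _ (mulmxr B)) hA => _ [u [hu ->]].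
  apply: (@lspan_map _ _ _ (G b) _ (mulmx (wmx X u))) hB => _ [v [hv ->]].
  apply: lspan_gen; exists (u ++ v); rewrite wmx_cat; split=> // i.
  by rewrite /wdeg count_cat -/(wdeg u i) -/(wdeg v i) hu hv.
elim: t => [i|a IHa b IHb] /=.
  by apply: lspan_gen; exists [:: i]; rewrite wmx1; split=> // j; rewrite /wdeg /= addn0.
rewrite -scaleNr; apply: lspanD; last by apply: lspanZ; exact: mulG.
apply: lspan_trans (mulG _ _ _ _ IHb IHa) => _ [w [hw ->]]; apply: lspan_gen.
by exists w; split=> // i; rewrite hw addnC.
Qed.

End TensorToMatrix.

(** * Graded dimensions of the braided Lie algebra *)

Section Dimension.
Variables (F : fieldType) (n p : nat) (q0 : F) (q : 'I_n -> 'I_n -> F).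
Hypothesis prim : p.+2.-primitive_root q0.
Hypothesis q_diag : forall i, q i i = q0.
Hypothesis q_adj : forall i j : 'I_n, j = i.+1 :> nat -> q i j * q j i = q0^-1.
Hypothesis q_far : forall i j : 'I_n, (i.+1 < j)%N || (j.+1 < i)%N -> q i j * q j i = 1.
Notation Rm := (Rm p q0 q).
Notation vac := (bas F (0 : expo n p)).

Definition conn_expo (e : expo n p) : bool := conn (fun l => (0 < deg e l)%N).

Lemma Phi_bvec t : Phi p q0 q (restrict (bsize t) (bvec q t)) = vac *m tmx q Rm t.
Proof.
rewrite -tensor_mx_bvec mulmx_sumr; apply: eq_bigr => w _.
by rewrite ffunE -scalemxAr.
Qed.

Lemma lspan_memv (V : vectType F) (G : V -> Prop) (U : {vspace V}) v :
  (forall g, G g -> g \in U) -> lspan G v -> v \in U.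
Proof.
by move=> h; elim=> [|c g u /h hg _ IH]; rewrite ?mem0v // memvD ?memvZ.
Qed.

Lemma cf_tmx t e : cf (vac *m tmx q Rm t) e != 0 -> deg e =1 bdeg t.
Proof.
move=> h; have [hd|hd] := boolP [forall l, deg e l == bdeg t l].
  by move=> l; apply/eqP; exact: (forallP hd).
case/eqP: h; elim: (tmx_word_span q Rm t) => [|c _ M [w [hw ->]] _ IH].
  by rewrite mulmx0 cf0.
rewrite mulmxDr -scalemxAr cfD cfZ IH addr0; apply/eqP; rewrite mulf_eq0.
apply/orP; right; apply: contraNT hd => /(cf_word prim) he.
by apply/forallP => l; rewrite he; apply/eqP; exact: hw.
Qed.

Lemma dim_span_bas (s : seq (expo n p)) : uniq s -> \dim (span [seq bas F e | e <- s]) = size s.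
Proof.
move=> us; rewrite -(size_map (fun e => bas F e) s); apply/eqP; rewrite -/(free _).
rewrite -[map _ _]/(val (in_tuple (map (fun e => bas F e) s))); apply/freeP => k hk i.
have lt_s (j : 'I_(size (map (fun e => bas F e) s))) : (j < size s)%N.
  by rewrite -[size s](size_map (fun e => bas F e)).
have := congr1 (fun v => cf v (nth 0 s i)) hk; rewrite cf0 cf_sum (bigD1 i) //=.
rewrite cfZ (nth_map 0) // cf_bas eqxx mulr1 big1 ?addr0 // => j ji.
by rewrite cfZ (nth_map 0) // cf_bas nth_uniq // [_ == _](negbTE ji) mulr0.
Qed.

Lemma dimL_card k :
  dimL q k = #|[set e : expo n p | (esize e == k) && conn_expo e]|.
Proof.
set S := [set e | _]; rewrite /dimL.
have -> : [seq omega q (restrict k (bvec q t)) | t <- btrees n k] =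
    [seq omega q u | u <- [seq restrict k (bvec q t) | t <- btrees n k]].
  by rewrite -map_comp.
rewrite (dim_omega_span prim q_diag q_adj q_far) -map_comp.
rewrite cardE -(dim_span_bas (enum_uniq S)); congr (\dim _).
apply: subv_anti; apply/andP; split; apply/span_subvP => v.
  case/mem_map_btrees => t tk -> /=; subst k; rewrite Phi_bvec.
  have [ct|dt] := boolP (ctree t); last first.
    by rewrite (tmx_disconnected (Rm_comm prim q_diag q_adj q_far) dt) mulmx0 mem0v.
  rewrite [vac *m _]bas_sum; apply: memv_suml => e _.
  have [->|he] := eqVneq (cf (vac *m tmx q Rm t) e) 0; first by rewrite scale0r mem0v.
  apply/memvZ/memv_span/map_f; rewrite mem_enum inE.
  have de := cf_tmx he; rewrite /esize (eq_bigr _ (fun l _ => de l)) sum_bdeg eqxx /=.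
  by rewrite /conn_expo (@eq_conn _ _ (fun l => (0 < bdeg t l)%N)) // => l; rewrite de.
case/mapP => e; rewrite mem_enum inE => /andP[/eqP ek ce] ->.
(* The words spanning [bas F e] have the degree of e, hence connected support, so each of them
   evaluates into the Lie algebra. *)
apply: lspan_memv (bas_word_span prim q_diag q_adj q_far e) => _ [w [hw ->]].
have wc : cword w.
  rewrite /cword (@eq_conn _ _ (fun l => (0 < deg e l)%N)) // => l.
  by rewrite -hw -has_count has_pred1.
have := connected_word_lie (isT : (1 < p.+2)%N) prim
  (q_neq0 prim q_diag q_adj q_far) q_diag q_adj q_far
  (Rm_comm prim q_diag q_adj q_far) (Rm_pow prim q_diag q_adj q_far) wc.
move=> hl; apply: (@lspan_memv _ (fun v => exists t, bdeg t =1 wdeg w /\ v = vac *m tmx q Rm t)).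
  move=> _ [t [ht ->]]; apply: memv_span; apply/mem_map_btrees.
  have tk : bsize t = k.
    by rewrite -sum_bdeg -ek; apply: eq_bigr => l _; rewrite ht -hw.
  by exists t => //=; rewrite -tk Phi_bvec.
apply: (@lspan_map _ _ _ _ _ (mulmx vac)) hl => _ [t [ht ->]].
by apply: lspan_gen; exists t.
Qed.

Lemma conn_expoE e : conn_expo e = (e \in conn_within n p n).
Proof.
rewrite inE (_ : e \in _) ?andTb; last first.
  by apply/withinP => r _; split=> //; apply: ltn_ord.
rewrite /conn_expo; apply/connP/interval_belowP => -[].
  case=> i hi h; split; first by exists i; rewrite ?in_supp_deg.
  move=> a b c ab bc cn; have bn := ltn_trans bc cn; have an := ltn_trans ab bn.
  rewrite -[a]/(val (Ordinal an)) -[b]/(val (Ordinal bn)) -[c]/(val (Ordinal cn)) !in_supp_deg.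
  by apply: h; rewrite /= ab.
case=> i im hi h; split; first by exists (Ordinal im); rewrite -in_supp_deg.
move=> a b c /andP[ab bc]; rewrite -!in_supp_deg; exact: h.
Qed.

Lemma sum_dimL : exists K : nat, (forall k, (K < k)%N -> dimL q k = 0%N) /\
  (\sum_(k < K.+1) dimL q k)%N = #|conn_within n p n|.
Proof.
pose K := \max_(e : expo n p) esize e; exists K; split=> [k kK|].
  rewrite dimL_card; apply: eq_card0 => e; rewrite inE; apply/andP => -[/eqP ek _].
  by move: kK; rewrite -ek ltnNge leq_bigmax.
under eq_bigr => k _ do rewrite dimL_card -sum1_card.
rewrite (exchange_big_dep (fun e => conn_expo e)) /= => [|k e _]; last first.
  by rewrite inE => /andP[].
rewrite -sum1_card; apply: eq_big => [e|e ce]; first exact: conn_expoE.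
have eK : (esize e < K.+1)%N by rewrite ltnS leq_bigmax.
rewrite (big_pred1 (Ordinal eK)) // => k; by rewrite inE ce andbT eq_sym.
Qed.

End Dimension.

Theorem theorem4p3 (F : closedFieldType) (n N : nat) (q0 : F)
  (q : 'I_n -> 'I_n -> F) :
  [pchar F] =i pred0 ->
  (1 <= n)%N -> (2 <= N)%N -> N.-primitive_root q0 ->
  (forall i : 'I_n, q i i = q0) ->
  (forall i j : 'I_n, j = i.+1 :> nat -> q i j * q j i = q0^-1) ->
  (forall i j : 'I_n, (i.+1 < j)%N || (j.+1 < i)%N -> q i j * q j i = 1) ->
  exists K : nat,
    (forall k, (K < k)%N -> dimL q k = 0%N) /\
    ((\sum_(k < K.+1) dimL q k)%N%:Z = rhs N n).
Proof.
move=> _ n1; case: N => [|[|p]] // _ prim q_diag q_adj q_far.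
have [K [hK sK]] := sum_dimL prim q_diag q_adj q_far; exists K; split=> //.
(* This J satisfies n <= 2J and makes j run from 0 to (n-1)/2; the term j = 0 is the leading power
   minus 1. *)
rewrite sK (@card_conn_within n p ((n - 1)./2).+1) //; last by rewrite -(odd_double_half (n - 1)); lia.
rewrite /rhs -(big_mkord xpredT (fun j => (-1) ^+ j * Schain p.+2 j n)) big_ltn //.
by rewrite expr0 mul1r.
Qed.
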